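(* Let $(\mathfrak{L}^{n+1},\mathfrak{g})$ be a static spacetime and $P^n\hookrightarrow\mathfrak{L}^{n+1}$ a non-degenerate equipotential photon surface. Then $$\frac{u\,\mathfrak{H}}{n}\left(1-\frac{\dot u^2}{u^2\nu(N)^2}\right)^{3/2}=\left(1-\frac{\dot u^2}{u^2\nu(N)^2}\right)\nu(N)+\frac1u\,Z\!\left(\frac{\dot u}{\nu(N)}\right)-\frac{\dot u^2}{u^2\nu(N)}$$ holds along $P^n$. If there is a sequence $(t_i)_{i\in\mathbb{N}}\subset\mathcal{T}\setminus\{t_0\}$ with accumulation point $t_0\in\mathcal{T}$ such that $\dot u(t_i)=0$ for all $i\in\mathbb{N}$, then $u(t_0)\mathfrak{H}(t_0)=n\,\nu(N)(t_0)$. If $P^n$ is a photon sphere, this gives $N\mathfrak{H}=n\,\nu(N)$ on $P^n$.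
   Context: All manifolds and tensor fields are smooth, manifolds are connected, submanifolds embedded; $n\ge3$. Static spacetime: $\mathfrak{L}^{n+1}=\mathbb{R}\times M^n$, $\mathfrak{g}=-N^2dt^2+g$ with $(M^n,g)$ Riemannian and $N\colon M^n\to(0,\infty)$; $M^n(t)$ is the time slice at $t$. Photon surface: a timelike totally umbilic hypersurface $P^n$ (equivalently, null geodesics initially tangent to $P^n$ remain tangent). Equipotential (no electric potential): $N$ is constant on each $\Sigma^{n-1}(t):=P^n\cap M^n(t)$. Photon sphere: a photon surface $P^n=\mathbb{R}\times\Sigma^{n-1}$, $\Sigma^{n-1}\hookrightarrow M^n$ a hypersurface, along which $N$ is constant. Non-degenerate: $dN\ne0$ at every point of $P^n$. $\mathcal{T}$ is the open interval of times $t$ with $\Sigma^{n-1}(t)\neq\emptyset$; $u\colon\mathcal{T}\to\mathbb{R}$, $u(t)=N|_{\Sigma^{n-1}(t)}$, $\dot u=\frac{du}{dt}$. $\eta$ is a unit normal to $P^n$, $\nu$ is the induced unit normal to $\Sigma^{n-1}(t)$ in $M^n(t)$, related by $\eta=\big(\nu+\frac{\dot u}{u^2\nu(N)}\partial_t\big)\big/\sqrt{1-\frac{\dot u^2}{u^2\nu(N)^2}}$. $Z=\partial_t+\frac{\dot u}{\nu(N)}\nu$ is the vector field tangent to $P^n$ and orthogonal to the slices $\Sigma^{n-1}(t)$. $\mathfrak{H}$ is the mean curvature (trace of the second fundamental form $\mathfrak{h}(X,Y)=-\mathfrak{g}(\nabla_XY,\eta)$) of $P^n$ w.r.t. $\eta$.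 $\mathfrak{H}(t_0)$, $\nu(N)(t_0)$ denote the restrictions to $\Sigma^{n-1}(t_0)$. *)

(* Defs.v *)
From mathcomp Require Import all_boot all_order all_algebra.
From mathcomp Require Import all_classical all_reals all_analysis.
Set Implicit Arguments. Unset Strict Implicit. Unset Printing Implicit Defensive.
Import Order.TTheory GRing.Theory Num.Theory.
Import numFieldNormedType.Exports.
Local Open Scope classical_set_scope.
Local Open Scope ring_scope.

(* C^oo on an open set U: every iterated partial derivative exists and is
   (Frechet) differentiable, in particular continuous, at every point of U. *)
Definition smooth_on (R : realType) (n : nat) (V : normedModType R)
    (U : set 'rV[R]_n) (F : 'rV[R]_n -> V) : Prop :=
  forall (s : seq 'I_n) (x : 'rV[R]_n), U x ->
    differentiable
      (foldr (fun i (h : 'rV[R]_n -> V) => fun y => 'D_(delta_mx 0 i) h y) F s) x.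

Record chart (R : realType) (n : nat) (T : topologicalType) := Chart {
  cdom : set T;
  cmap : T -> 'rV[R]_n;
  cinv : 'rV[R]_n -> T }.

Definition is_chart (R : realType) (n : nat) (T : topologicalType)
    (c : chart R n T) : Prop :=
  [/\ open (cdom c),
      open (cmap c @` cdom c),
      forall x, cdom c x -> cinv c (cmap c x) = x,
      forall x, cdom c x -> {for x, continuous (cmap c)} &
      forall y, (cmap c @` cdom c) y -> {for y, continuous (cinv c)}].

(* A topological space with an atlas, and with a preferred chart [chart_at p]
   around each point p. The tangent space at p is 'rV[R]_n: a vector is given by
   its components in the chart [chart_at p]. The preferred charts need not depend
   continuously on p, so a vector field is smooth when its components in every
   fixed chart of the atlas (see [chart_jac]) are smooth. *)
Record chartedSpace (R : realType) (n : nat) := ChartedSpace {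
  cs_top :> topologicalType;
  atlas : set (chart R n cs_top);
  chart_at : cs_top -> chart R n cs_top }.

Definition is_manifold (R : realType) (n : nat) (X : chartedSpace R n) : Prop :=
  [/\ hausdorff_space X, @second_countable X & connected [set: X]] /\
  [/\ forall c : chart R n X, atlas c -> is_chart c,
      forall p : X, atlas (chart_at p) /\ cdom (chart_at p) p &
      forall a b : chart R n X, atlas a -> atlas b ->
        smooth_on (cmap a @` (cdom a `&` cdom b)) (cmap b \o cinv a)].

(* [v *m chart_jac c p] lists the components in the chart c of the tangent
   vector v at p. *)
Definition chart_jac (R : realType) (n : nat) (X : chartedSpace R n)
    (c : chart R n X) (p : X) : 'M[R]_n :=
  'J (cmap c \o cinv (chart_at p)) (cmap (chart_at p) p).

(* The inverse change of components: row i is the i-th coordinate vector of the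
   chart c at p. *)
Definition chart_frame (R : realType) (n : nat) (X : chartedSpace R n)
    (c : chart R n X) (p : X) : 'M[R]_n :=
  'J (cmap (chart_at p) \o cinv c) (cmap c p).

Definition smooth_fun (R : realType) (n : nat) (X : chartedSpace R n)
    (f : X -> R) : Prop :=
  forall c : chart R n X, atlas c ->
    smooth_on (cmap c @` cdom c) (f \o cinv c : 'rV[R]_n -> R^o).

(* The derivative v(f) at p of a function f along the tangent vector v at p. *)
Definition tderiv (R : realType) (n : nat) (X : chartedSpace R n)
    (V : normedModType R) (f : X -> V) (p : X) (v : 'rV[R]_n) : V :=
  'D_v (f \o cinv (chart_at p)) (cmap (chart_at p) p).

Definition smooth_map (R : realType) (m n : nat)
    (X : chartedSpace R m) (Y : chartedSpace R n) (f : X -> Y) : Prop :=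
  continuous f /\
  forall (a : chart R m X) (b : chart R n Y), atlas a -> atlas b ->
    smooth_on (cmap a @` (cdom a `&` f @^-1` cdom b)) (cmap b \o f \o cinv a).

(* The differential of f at p, acting on tangent vectors as v |-> v *m tmap f p. *)
Definition tmap (R : realType) (m n : nat)
    (X : chartedSpace R m) (Y : chartedSpace R n) (f : X -> Y) (p : X)
    : 'M[R]_(m, n) :=
  'J (cmap (chart_at (f p)) \o f \o cinv (chart_at p)) (cmap (chart_at p) p).

Definition embedding (R : realType) (m n : nat)
    (X : chartedSpace R m) (Y : chartedSpace R n) (f : X -> Y) : Prop :=
  [/\ smooth_map f, injective f, forall p, row_free (tmap f p) &
      forall A : set X, open A ->
        exists2 B : set Y, open B & f @` A = range f `&` B].

(* Vector fields of Y along a map f : X -> Y are functions X -> 'rV[R]_n whose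
   value at p is a tangent vector at f p. *)
Definition smooth_field_along (R : realType) (m n : nat)
    (X : chartedSpace R m) (Y : chartedSpace R n) (f : X -> Y)
    (V : X -> 'rV[R]_n) : Prop :=
  forall (a : chart R m X) (b : chart R n Y), atlas a -> atlas b ->
    smooth_on (cmap a @` (cdom a `&` f @^-1` cdom b))
      ((fun p => V p *m chart_jac b (f p)) \o cinv a).

Definition inner (R : realType) (n : nat) (A : 'M[R]_n) (v w : 'rV[R]_n) : R :=
  (v *m A *m w^T) 0 0.

(* A metric G gives the Gram matrix G p on the tangent space at p; [metric_in G c]
   is its coordinate expression in the chart c. *)
Definition metric_in (R : realType) (n : nat) (X : chartedSpace R n)
    (G : X -> 'M[R]_n) (c : chart R n X) (q : 'rV[R]_n) : 'M[R]_n :=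
  chart_frame c (cinv c q) *m G (cinv c q) *m (chart_frame c (cinv c q))^T.

Definition is_riemannian (R : realType) (n : nat) (X : chartedSpace R n)
    (G : X -> 'M[R]_n) : Prop :=
  [/\ forall p, (G p)^T = G p,
      forall p (v : 'rV[R]_n), v != 0 -> 0 < inner (G p) v v &
      forall (c : chart R n X) (i j : 'I_n), atlas c ->
        smooth_on (cmap c @` cdom c) (fun q => metric_in G c q i j : R^o)].

(* Signature (-, +, ..., +). *)
Definition is_lorentzian (R : realType) (n : nat) (A : 'M[R]_n) : Prop :=
  exists2 B : 'M[R]_n, B \in unitmx &
    B *m A *m B^T =
      diag_mx (\row_(i < n) (if (i == 0 :> nat) then -1 else 1)).

(* Gamma^k_{ij} of the chart c at the coordinate point q. *)
Definition christoffel (R : realType) (n : nat) (X : chartedSpace R n)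
    (G : X -> 'M[R]_n) (c : chart R n X) (q : 'rV[R]_n) (k i j : 'I_n) : R :=
  let pd (l a b : 'I_n) : R :=
    'D_(delta_mx 0 l) (fun y => metric_in G c y a b : R^o) q in
  2^-1 * \sum_(l < n)
    invmx (metric_in G c q) k l * (pd i j l + pd j i l - pd l i j).

(* The Levi-Civita derivative, along f, of the vector field V along f in the
   direction of the tangent vector w at p. Working in the preferred chart at f p,
   in which V p and w *m tmap f p are already expressed, the components of the
   result are w(V^k) + Gamma^k_{ij} (df w)^i V^j. *)
Definition covd (R : realType) (m n : nat)
    (X : chartedSpace R m) (Y : chartedSpace R n) (G : Y -> 'M[R]_n)
    (f : X -> Y) (V : X -> 'rV[R]_n) (p : X) (w : 'rV[R]_m) : 'rV[R]_n :=
  let c := chart_at (f p) in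
  let dV := tderiv (fun q => V q *m chart_jac c (f q)) p w in
  \row_(k < n) (dV 0 k + \sum_(i < n) \sum_(j < n)
    christoffel G c (cmap c (f p)) k i j * (w *m tmap f p) 0 i * V p 0 j).

Definition induced_metric (R : realType) (m n : nat)
    (X : chartedSpace R m) (Y : chartedSpace R n) (G : Y -> 'M[R]_n)
    (f : X -> Y) (p : X) : 'M[R]_m :=
  tmap f p *m G (f p) *m (tmap f p)^T.

Definition unit_normal (R : realType) (m n : nat)
    (X : chartedSpace R m) (Y : chartedSpace R n) (G : Y -> 'M[R]_n)
    (f : X -> Y) (p : X) (e : 'rV[R]_n) : Prop :=
  inner (G (f p)) e e = 1 /\
  forall w : 'rV[R]_m, inner (G (f p)) (w *m tmap f p) e = 0.

Definition sff_fields (R : realType) (m n : nat)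
    (X : chartedSpace R m) (Y : chartedSpace R n) (G : Y -> 'M[R]_n)
    (f : X -> Y) (p : X) (e : 'rV[R]_n) (A B : X -> 'rV[R]_m) : R :=
  - inner (G (f p)) (covd G f (fun q => B q *m tmap f q) p (A p)) e.

(* The tangent vector v at p, extended to the domain of [chart_at p] with constant
   components in that chart. *)
Definition extend (R : realType) (m : nat) (X : chartedSpace R m)
    (p : X) (v : 'rV[R]_m) (q : X) : 'rV[R]_m :=
  v *m chart_frame (chart_at p) q.

(* The second fundamental form at p with respect to the normal vector e. Being
   tensorial, [sff_fields] does not depend on the extensions of v and w. *)
Definition sff (R : realType) (m n : nat)
    (X : chartedSpace R m) (Y : chartedSpace R n) (G : Y -> 'M[R]_n)
    (f : X -> Y) (p : X) (e : 'rV[R]_n) (v w : 'rV[R]_m) : R :=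
  sff_fields G f p e (extend p v) (extend p w).

Definition mean_curvature (R : realType) (m n : nat)
    (X : chartedSpace R m) (Y : chartedSpace R n) (G : Y -> 'M[R]_n)
    (f : X -> Y) (p : X) (e : 'rV[R]_n) : R :=
  \tr (invmx (induced_metric G f p) *m
       \matrix_(i < m, j < m) sff G f p e (delta_mx 0 i) (delta_mx 0 j)).

Definition timelike (R : realType) (m n : nat)
    (X : chartedSpace R m) (Y : chartedSpace R n) (G : Y -> 'M[R]_n)
    (f : X -> Y) : Prop :=
  forall p, is_lorentzian (induced_metric G f p).

Definition totally_umbilic (R : realType) (m n : nat)
    (X : chartedSpace R m) (Y : chartedSpace R n) (G : Y -> 'M[R]_n)
    (f : X -> Y) : Prop :=
  forall (p : X) (e : 'rV[R]_n), unit_normal G f p e ->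
    exists lambda : R, forall v w : 'rV[R]_m,
      sff G f p e v w = lambda * inner (induced_metric G f p) v w.

Definition line_chart (R : realType) (n : nat) (T : topologicalType)
    (c : chart R n T) : chart R (1 + n) (R * T)%type :=
  @Chart R (1 + n) (R * T)%type
    [set p | cdom c p.2]
    (fun p => row_mx (p.1)%:M (cmap c p.2))
    (fun q : 'rV[R]_(1 + n) => (lsubmx q 0 0, cinv c (rsubmx q))).

(* The product manifold R x M; tangent vectors at (t, x) are [row_mx a v], with
   a the d/dt component and v tangent to M at x. *)
Definition line_times (R : realType) (n : nat) (M : chartedSpace R n)
    : chartedSpace R (1 + n) :=
  @ChartedSpace R (1 + n) (R * M)%type
    [set line_chart c | c in @atlas R n M]
    (fun p => line_chart (chart_at p.2)).

Definition time_of (R : realType) (n : nat) (M : chartedSpace R n)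
    (p : line_times M) : R := p.1.

Definition space_of (R : realType) (n : nat) (M : chartedSpace R n)
    (p : line_times M) : M := p.2.

Definition ddt (R : realType) (n : nat) : 'rV[R]_(1 + n) := row_mx 1%:M 0.

Definition horizontal (R : realType) (n : nat) (v : 'rV[R]_n) : 'rV[R]_(1 + n) :=
  row_mx 0 v.

Definition static_metric (R : realType) (n : nat) (M : chartedSpace R n)
    (g : M -> 'M[R]_n) (N : M -> R) (p : line_times M) : 'M[R]_(1 + n) :=
  block_mx (- N (space_of p) ^+ 2)%:M 0 0 (g (space_of p)).

Definition static_spacetime (R : realType) (n : nat) (M : chartedSpace R n)
    (g : M -> 'M[R]_n) (N : M -> R) : Prop :=
  [/\ is_manifold M, is_riemannian g, smooth_fun N & forall x, 0 < N x].

Definition photon_surface (R : realType) (n : nat) (M : chartedSpace R n)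
    (g : M -> 'M[R]_n) (N : M -> R)
    (P : chartedSpace R n) (f : P -> line_times M) : Prop :=
  [/\ is_manifold P, embedding f, timelike (static_metric g N) f &
      totally_umbilic (static_metric g N) f].

Definition slice (R : realType) (n : nat) (M : chartedSpace R n)
    (P : chartedSpace R n) (f : P -> line_times M) (t : R) : set P :=
  [set p | time_of (f p) = t].

Definition equipotential (R : realType) (n : nat) (M : chartedSpace R n)
    (N : M -> R) (P : chartedSpace R n) (f : P -> line_times M) : Prop :=
  forall (t : R) (p q : P), slice f t p -> slice f t q ->
    N (space_of (f p)) = N (space_of (f q)).

Definition non_degenerate (R : realType) (n : nat) (M : chartedSpace R n)
    (N : M -> R) (P : chartedSpace R n) (f : P -> line_times M) : Prop :=
  forall p : P, exists v : 'rV[R]_n,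
    tderiv (N : M -> R^o) (space_of (f p)) v != 0.

Definition photon_sphere (R : realType) (n : nat) (M : chartedSpace R n)
    (g : M -> 'M[R]_n) (N : M -> R)
    (P : chartedSpace R n) (f : P -> line_times M) : Prop :=
  [/\ photon_surface g N f,
      exists (S : chartedSpace R n.-1) (j : S -> M),
        [/\ is_manifold S, embedding j & range f = [set: R] `*` range j] &
      forall p q : P, N (space_of (f p)) = N (space_of (f q))].

Definition slice_times (R : realType) (n : nat) (M : chartedSpace R n)
    (P : chartedSpace R n) (f : P -> line_times M) : set R :=
  [set t | slice f t !=set0].

Definition slice_value (R : realType) (n : nat) (M : chartedSpace R n)
    (N : M -> R) (P : chartedSpace R n) (f : P -> line_times M) (t : R) : R :=
  xget 0 [set N (space_of (f p)) | p in slice f t].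

(* The tangent space of Sigma(t) at p consists of the vectors tangent to P that
   have no d/dt component. *)
Definition slice_unit_normal (R : realType) (n : nat) (M : chartedSpace R n)
    (g : M -> 'M[R]_n) (P : chartedSpace R n) (f : P -> line_times M)
    (p : P) (v : 'rV[R]_n) : Prop :=
  inner (g (space_of (f p))) v v = 1 /\
  forall w x : 'rV[R]_n, w *m tmap f p = horizontal x ->
    inner (g (space_of (f p))) x v = 0.

(* Z(h) at p, for h a function on P and Z a vector at f p tangent to P: the
   derivative of h along the vector of P that the differential of f maps to Z. *)
Definition tangent_deriv (R : realType) (m n : nat)
    (X : chartedSpace R m) (Y : chartedSpace R n) (f : X -> Y)
    (h : X -> R) (p : X) (Z : 'rV[R]_n) : R :=
  tderiv (h : X -> R^o) p (xget 0 [set w : 'rV[R]_m | w *m tmap f p = Z]).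

(* Main.v *)
(* Write h = u' / nu(N) and s = (1 - h^2 / u^2)^(-1/2), so that
   eta = s (nu + (h / u^2) d/dt) and Z = d/dt + h nu.  Since P is umbilic with
   factor H / n, the number H / n * <Z, Z> = - (H / n) (u^2 - h^2) equals the
   second fundamental form II(Z, Z).  In a chart, differentiating <Z, eta> = 0
   along P turns II(Z, Z) into <Z, D_Z eta> + (1/2) (d_eta g)(Z, Z), where D_Z
   and d_eta differentiate components.  The g-derivatives drop out thanks to
   |nu| = 1, which leaves
     II(Z, Z) = - s Z(h) + 2 s h^2 nu(N) / u - u s nu(N).
   No regularity of u is needed: s and h are read off from the components of the
   smooth field eta.  If u' vanishes at times accumulating at t0, then along a
   curve in P with velocity Z, on which time has derivative 1, h has zeros
   accumulating at the base point, so h and Z(h) vanish there. *)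
Require Import Defs.
From mathcomp Require Import all_boot all_order all_algebra.
From mathcomp Require Import all_classical all_reals all_analysis.
From mathcomp Require Import ring lra.
Import Order.TTheory GRing.Theory Num.Theory.
Import numFieldNormedType.Exports.
Local Open Scope classical_set_scope.
Local Open Scope ring_scope.
Set Implicit Arguments.
Unset Strict Implicit.
Unset Printing Implicit Defensive.

(** * Differentiation *)

(** Differentiability depends only on the germ at [x]: the first-order expansion of [f] carries over
    to [g], and uniqueness of the differential identifies ['d g x] with ['d f x]. Chart expressions
    agree only near a base point, hence the need for such transfers. *)
Lemma near_eq_differentiable (R : numFieldType) (V W : normedModType R)
    (f g : V -> W) (x : V) :
  {near x, f =1 g} -> differentiable f x -> differentiable g x.
Proof.
move=> fg df.
have gE : g \o shift x = cst (g x) + 'd f x +o_ 0 id.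
  apply/eqaddoP => e e0.
  have /eqaddoP /(_ e e0) fo := diff_locally df.
  have fg0 : \forall y \near (0 : V), f (y + x) = g (y + x).
    suff shx : (fun y => y + x) @ (0 : V) --> x by exact: shx _ fg.
    by rewrite -{2}(add0r x); apply: cvgD; [exact: cvg_id|exact: cvg_cst].
  have fgx : f x = g x by exact: nbhs_singleton fg.
  apply: filterS2 fo fg0 => y fo fgy; apply: le_trans fo.
  by rewrite !fctE /= /shift /= fgy fgx.
have dgE : 'd g x = 'd f x :> (V -> W).
  by apply: diff_unique gE; exact: diff_continuous df.
by apply/diff_locallyP; rewrite dgE; split => //; exact: diff_continuous df.
Qed.

Lemma differentiable_mx (R : realFieldType) (V : normedModType R) (m n : nat)
    (M : V -> 'M[R]_(m, n)) (x : V) :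
  (forall i j, differentiable (fun y => M y i j : R^o) x) ->
  differentiable M x.
Proof.
move=> dM.
have -> : M = \sum_(i < m) \sum_(j < n) (fun y => M y i j *: delta_mx i j).
  apply/funext => y; rewrite [LHS]matrix_sum_delta fct_sumE.
  by apply: eq_bigr => i _; rewrite fct_sumE.
apply: (@differentiable_sum R V 'M[R]_(m, n) m) => i /=.
refine (@differentiable_sum R V 'M[R]_(m, n) n _ x _) => j /=.
exact: differentiableZl.
Qed.

Lemma differentiable_mxE (R : realFieldType) (V : normedModType R) (m n : nat)
    (M : V -> 'M[R]_(m, n)) (x : V) i j :
  differentiable M x -> differentiable (fun y => M y i j : R^o) x.
Proof.
move=> dM.
exact: (@differentiable_comp _ _ _ _ M (fun N : 'M[R]_(m, n) => N i j : R^o)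
  x dM (differentiable_coord (M x) i j)).
Qed.

Lemma is_derive_mx (R : realFieldType) (V : normedModType R) (m n : nat)
    (M : V -> 'M[R]_(m, n)) (dM : 'M[R]_(m, n)) (x v : V) :
  (forall i j, is_derive x v (fun y => M y i j : R^o) (dM i j)) ->
  is_derive x v M dM.
Proof.
move=> dMij; have dM' : derivable M x v.
  by apply/derivable_mxP => i j; case: (dMij i j).
apply: DeriveDef => //; rewrite derive_mx //.
by apply/matrixP => i j; rewrite mxE; case: (dMij i j).
Qed.

Lemma is_derive_mxE (R : realFieldType) (V : normedModType R) (m n : nat)
    (M : V -> 'M[R]_(m, n)) (dM : 'M[R]_(m, n)) (x v : V) i j :
  is_derive x v M dM -> is_derive x v (fun y => M y i j : R^o) (dM i j).
Proof.
case=> dM' <-; apply: DeriveDef; first exact: ((derivable_mxP M x v).1 dM' i j).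
by rewrite derive_mx // mxE.
Qed.

Lemma is_derive_mulmx (R : realFieldType) (V : normedModType R) (m n p : nat)
    (A : V -> 'M[R]_(m, n)) (B : V -> 'M[R]_(n, p)) dA dB (x v : V) :
  is_derive x v A dA -> is_derive x v B dB ->
  is_derive x v (fun y => A y *m B y) (dA *m B x + A x *m dB).
Proof.
move=> hA hB; apply: is_derive_mx => i j.
have -> : (fun y => (A y *m B y) i j : R^o) =
    \sum_(k < n) ((fun y => A y i k : R^o) * (fun y => B y k j : R^o)).
  by apply/funext => y; rewrite mxE fct_sumE.
rewrite !mxE -big_split /=.
apply: is_derive_eq.
  apply: is_derive_sum => k; apply: is_deriveM; exact: is_derive_mxE.
by apply: eq_bigr => k _; rewrite /GRing.scale /= addrC [B x k j * _]mulrC.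
Qed.

Lemma is_derive_trmx (R : realFieldType) (V : normedModType R) (m n : nat)
    (A : V -> 'M[R]_(m, n)) dA (x v : V) :
  is_derive x v A dA -> is_derive x v (fun y => (A y)^T) dA^T.
Proof.
move=> hA; apply: is_derive_mx => i j; rewrite mxE.
rewrite (_ : (fun _ => _) = fun y => A y j i : R^o); first exact: is_derive_mxE.
by apply/funext => y; rewrite mxE.
Qed.

Lemma is_derive_inner (R : realType) (V : normedModType R) (n : nat)
    (A : V -> 'M[R]_n) (a b : V -> 'rV[R]_n) dA da db (x v : V) :
  is_derive x v A dA -> is_derive x v a da -> is_derive x v b db ->
  is_derive x v (fun y => inner (A y) (a y) (b y) : R^o)
    (inner dA (a x) (b x) + inner (A x) da (b x) + inner (A x) (a x) db).
Proof.
move=> hA ha hb.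
have := is_derive_mulmx (is_derive_mulmx ha hA) (is_derive_trmx hb).
move=> /(is_derive_mxE 0 0) h; apply: (is_derive_eq h).
by rewrite mulmxDl [LHS]mxE [X in X + _]mxE [X in X + _]addrC.
Qed.

Lemma diff_is_derive (R : numFieldType) (V W : normedModType R) (f : V -> W)
    (x v : V) : differentiable f x -> is_derive x v f ('d f x v).
Proof.
by move=> df; apply: DeriveDef; [exact: diff_derivable|rewrite deriveE].
Qed.

Lemma is_derive_comp (R : numFieldType) (U V W : normedModType R)
    (f : U -> V) (g : V -> W) (x v : U) :
  differentiable f x -> differentiable g (f x) ->
  is_derive x v (g \o f) ('D_('D_v f x) g (f x)).
Proof.
move=> df dg; have h := diff_is_derive v (differentiable_comp df dg).
by apply: (is_derive_eq h); rewrite diff_comp //= !deriveE.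
Qed.

Lemma row_jacobian (R : realType) (m n : nat) (f : 'rV[R]_m -> 'rV[R]_n) x i :
  differentiable f x -> row i ('J f x) = 'D_(delta_mx 0 i) f x.
Proof. by move=> df; rewrite rowE (deriveEjacobian _ df). Qed.

Lemma jacobian_comp (R : realType) (m n p : nat) (f : 'rV[R]_m -> 'rV[R]_n)
    (g : 'rV[R]_n -> 'rV[R]_p) x :
  differentiable f x -> differentiable g (f x) ->
  'J (g \o f) x = 'J f x *m 'J g (f x).
Proof.
move=> df dg; apply/row_matrixP => i; rewrite row_mul (row_jacobian _ df).
rewrite (row_jacobian _ (differentiable_comp df dg)) -(deriveEjacobian _ dg).
by case: (is_derive_comp (delta_mx 0 i) df dg).
Qed.

Lemma jacobian_near_eq (R : realType) (m n : nat)
    (f g : 'rV[R]_m -> 'rV[R]_n) x :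
  {near x, f =1 g} -> differentiable f x -> 'J f x = 'J g x.
Proof.
move=> fg df; have dg := near_eq_differentiable fg df.
apply/row_matrixP => i.
apply: etrans (row_jacobian i df) (etrans _ (esym (row_jacobian i dg))).
exact: near_eq_derive fg.
Qed.

Lemma jacobian_id (R : realType) (m : nat) (x : 'rV[R]_m) : 'J id x = 1%:M.
Proof.
have did : differentiable (@id 'rV[R]_m) x by exact: ex_diff.
by apply/row_matrixP => i; rewrite (row_jacobian _ did) derive_id row1.
Qed.

(** * Charts *)

(** [cmap] and [cinv] are mutually inverse only on the domain and image of the chart. Openness of
    the image and continuity of [cinv] turn this into statements valid near [cmap c x], which is all
    that derivatives see. *)
Lemma chart_near (R : realType) (n : nat) (T : topologicalType)
    (c : chart R n T) (x : T) (U : set T) :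
  is_chart c -> cdom c x -> nbhs x U ->
  \forall y \near cmap c x,
    [/\ U (cinv c y), cdom c (cinv c y) & cmap c (cinv c y) = y].
Proof.
move=> [_ oI cK _ cV] cx Ux.
have Icx : (cmap c @` cdom c) (cmap c x) by exists x.
have := cV _ Icx; rewrite /prop_for /continuous_at cK // => /(_ _ Ux) Uy.
apply: filterS2 (open_nbhs_nbhs (conj oI Icx)) Uy => y [z cz <-] /=.
by rewrite cK.
Qed.

Lemma cmapK_near (R : realType) (n : nat) (T : topologicalType)
    (c : chart R n T) (x : T) :
  is_chart c -> cdom c x -> {near cmap c x, cmap c \o cinv c =1 id}.
Proof.
move=> cc cx; have xT : nbhs x setT by exact: filterT.
by have := chart_near cc cx xT; apply: filterS => y [].
Qed.

(** Passing through [b] and back is harmless where [f] stays in [cdom b], which continuity ensures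
    near [x]; the chain rule does the rest. With [f] or [g] the identity this is a change of
    charts. *)
Lemma jacobian_chart_comp (R : realType) (m n p : nat) (S T U : topologicalType)
    (a : chart R m S) (b : chart R n T) (c : chart R p U) (f : S -> T)
    (g : T -> U) (x : S) :
  is_chart a -> is_chart b -> cdom a x -> cdom b (f x) ->
  {for x, continuous f} ->
  differentiable (cmap b \o f \o cinv a) (cmap a x) ->
  differentiable (cmap c \o g \o cinv b) (cmap b (f x)) ->
  differentiable (cmap c \o (g \o f) \o cinv a) (cmap a x) /\
  'J (cmap c \o (g \o f) \o cinv a) (cmap a x) =
  'J (cmap b \o f \o cinv a) (cmap a x)
    *m 'J (cmap c \o g \o cinv b) (cmap b (f x)).
Proof.
move=> ca cb ax bfx cf; have [_ _ aK _ _] := ca; have [bo _ bK _ _] := cb.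
have fx : (cmap b \o f \o cinv a) (cmap a x) = cmap b (f x) by rewrite /= aK.
move=> df dg0.
have dg : differentiable (cmap c \o g \o cinv b)
  ((cmap b \o f \o cinv a) (cmap a x)) by rewrite fx.
have nE : {near cmap a x, (cmap c \o g \o cinv b) \o (cmap b \o f \o cinv a)
    =1 cmap c \o (g \o f) \o cinv a}.
  have /(chart_near ca ax) := cf _ (open_nbhs_nbhs (conj bo bfx)).
  by apply: filterS => y [/= bfy _ _]; rewrite bK.
have dgf := differentiable_comp df dg.
split; first exact: near_eq_differentiable nE dgf.
by rewrite -(jacobian_near_eq nE dgf) (jacobian_comp df dg) fx.
Qed.

(** The first-order content of [is_manifold]: it supports the chain rule between charts and passes
    directly to [line_times M]. *)
Definition differentiable_atlas (R : realType) (n : nat)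
    (X : chartedSpace R n) :=
  [/\ forall c : chart R n X, atlas c -> is_chart c,
      forall p : X, atlas (chart_at p) /\ cdom (chart_at p) p &
      forall a b : chart R n X, atlas a -> atlas b ->
        forall x, cdom a x -> cdom b x ->
          differentiable (cmap b \o cinv a) (cmap a x)].

Lemma manifold_differentiable_atlas (R : realType) (n : nat)
    (X : chartedSpace R n) : is_manifold X -> differentiable_atlas X.
Proof.
case=> _ [ch at_ tr]; split=> // a b ata atb x ax bx.
by have := tr _ _ ata atb [::] (cmap a x); apply; exists x.
Qed.

(** Going from [c] to the preferred chart and back is the identity near the base point, so the chain
    rule makes the two Jacobians inverse to each other. *)
Lemma chart_frameK (R : realType) (n : nat) (X : chartedSpace R n)
    (c : chart R n X) (p : X) : differentiable_atlas X -> atlas c -> cdom c p ->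
  chart_frame c p *m chart_jac c p = 1%:M.
Proof.
move=> [ch at_ tr] atc cp; have [atp p_p] := at_ p.
have [] := @jacobian_chart_comp _ _ _ _ _ _ _ c (chart_at p) c id id p
  (ch _ atc) (ch _ atp) cp p_p (@cvg_id _ _) (tr _ _ atc atp _ cp p_p)
  (tr _ _ atp atc _ p_p cp).
move=> d; rewrite /chart_frame /chart_jac => <-.
by rewrite (jacobian_near_eq (cmapK_near (ch _ atc) cp) d) jacobian_id.
Qed.

Lemma chart_jacK (R : realType) (n : nat) (X : chartedSpace R n)
    (c : chart R n X) (p : X) : differentiable_atlas X -> atlas c -> cdom c p ->
  chart_jac c p *m chart_frame c p = 1%:M.
Proof. by move=> dX atc cp; apply: mulmx1C; apply: chart_frameK. Qed.

Lemma chart_frame_at (R : realType) (n : nat) (X : chartedSpace R n) (p : X) :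
  differentiable_atlas X -> chart_frame (chart_at p) p = 1%:M.
Proof.
move=> [ch at_ tr]; have [atp p_p] := at_ p.
rewrite /chart_frame -(jacobian_id (cmap (chart_at p) p)).
by apply: jacobian_near_eq (cmapK_near (ch _ atp) p_p) _; exact: tr.
Qed.

Lemma chart_jac_at (R : realType) (n : nat) (X : chartedSpace R n) (p : X) :
  differentiable_atlas X -> chart_jac (chart_at p) p = 1%:M.
(* For [c := chart_at p] the frame and the Jacobian are the same term. *)
Proof. exact: chart_frame_at. Qed.

(** [tmap f x] refers to preferred charts, which may jump with [x]. The chain rule through them
    gives the Jacobian of one map between fixed charts, an expression that can be differentiated in
    [x]. *)
Lemma tmap_in_charts (R : realType) (m n : nat) (X : chartedSpace R m)
    (Y : chartedSpace R n) (f : X -> Y) (a : chart R m X) (b : chart R n Y) x :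
  differentiable_atlas X -> differentiable_atlas Y -> smooth_map f ->
  atlas a -> atlas b -> cdom a x -> cdom b (f x) ->
  chart_frame a x *m tmap f x *m chart_jac b (f x) =
  'J (cmap b \o f \o cinv a) (cmap a x).
Proof.
move=> [chX atX trX] [chY atY trY] [cf df] ata atb ax bfx.
have [atx xx] := atX x; have [atfx fxfx] := atY (f x).
have dfx : differentiable (cmap (chart_at (f x)) \o f \o cinv (chart_at x))
    (cmap (chart_at x) x).
  by apply: (df _ _ atx atfx [::]); exists x.
have [d1 J1] := @jacobian_chart_comp _ _ _ _ _ _ _ a (chart_at x)
  (chart_at (f x)) id f x (chX _ ata) (chX _ atx) ax xx (@cvg_id _ _)
  (trX _ _ ata atx _ ax xx) dfx.
have [_ ->] := @jacobian_chart_comp _ _ _ _ _ _ _ a (chart_at (f x)) b f id x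
  (chX _ ata) (chY _ atfx) ax fxfx (cf x) d1 (trY _ _ atfx atb _ fxfx bfx).
by rewrite /chart_frame /tmap /chart_jac -J1.
Qed.

(** * The product manifold *)

(** A neighbourhood of a matrix contains a product of neighbourhoods of its entries, and these are
    finitely many conditions. *)
Lemma cvg_mx (I : Type) (F : set_system I) (T : topologicalType) (m n : nat)
    (f : I -> 'M[T]_(m, n)) (M : 'M[T]_(m, n)) : Filter F ->
  (forall i j, (fun x => f x i j) @ F --> M i j) -> f @ F --> M.
Proof.
move=> FF fM A [P PM PA].
apply: (@filterS _ F _ (f @^-1` [set N | forall i j, P i j (N i j)])).
  by move=> x; apply: PA.
apply: filter_forall => i; apply: filter_forall => j.
exact: fM.
Qed.

Lemma line_is_chart (R : realType) (n : nat) (T : topologicalType)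
    (c : chart R n T) : is_chart c -> is_chart (line_chart c).
Proof.
case=> oc oI cK cc cV.
(* The image is the line times the image of [c]; as a preimage under the continuous [rsubmx] it is
   open. *)
have imE : cmap (line_chart c) @` cdom (line_chart c) =
    rsubmx @^-1` (cmap c @` cdom c).
  apply/seteqP; split=> [z [[t x] /= cx <-]|z /= [x cx xz]].
    by exists x => //; rewrite row_mxKr.
  exists (lsubmx z 0 0, x) => //=.
  by rewrite xz -mx11_scalar hsubmxK.
split.
- by apply: open_comp oc => p _; exact: cvg_snd.
- rewrite imE; apply: (@open_comp _ _ (@rsubmx R 1 1 n)) oI => z _.
  exact: continuous_rsubmx.
- by case=> t x cx /=; rewrite row_mxKl row_mxKr mxE eqxx mulr1n cK.
- case=> t x cx; apply: cvg_mx => i j; rewrite !mxE.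
  case: (splitP j) => k jk.
    rewrite (ord1 i) (ord1 k) mxE eqxx mulr1n.
    rewrite (_ : (fun p => _) = fst); first exact: cvg_fst.
    apply/funext => p; rewrite (_ : j = lshift n 0); last first.
      by apply: val_inj; rewrite /= jk (ord1 k).
    by rewrite row_mxEl mxE eqxx mulr1n.
  rewrite (_ : (fun p => _) =
    (fun y : 'rV[R]_n => y i k) \o (cmap c \o snd)); last first.
    apply/funext => p; rewrite (_ : j = rshift 1 k); last exact/val_inj.
    by rewrite row_mxEr.
  apply: (@cvg_comp _ _ _ _ _ _ (nbhs (cmap c x))).
    apply: (@cvg_comp _ _ _ _ _ _ (nbhs x)); [exact: cvg_snd|exact: cc].
  exact: coord_continuous.
- move=> z; rewrite imE => zI.
  have hl : (fun y : 'rV[R]_(1 + n) => lsubmx y 0 0) @ z --> lsubmx z 0 0.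
    apply: (@cvg_comp _ _ _ (@lsubmx R 1 1 n) (fun y : 'M[R]_1 => y 0 0) _
      (nbhs (lsubmx z))); first exact: continuous_lsubmx.
    exact: coord_continuous.
  have hr : (fun y : 'rV[R]_(1 + n) => cinv c (rsubmx y)) @ z -->
      cinv c (rsubmx z).
    apply: (@cvg_comp _ _ _ (@rsubmx R 1 1 n) (cinv c) _ (nbhs (rsubmx z))).
      exact: continuous_rsubmx.
    exact: cV.
  exact: cvg_pair hl hr.
Qed.

Lemma is_derive_row_mx (R : realFieldType) (V : normedModType R) (m n1 n2 : nat)
    (A : V -> 'M[R]_(m, n1)) (B : V -> 'M[R]_(m, n2)) dA dB (x v : V) :
  is_derive x v A dA -> is_derive x v B dB ->
  is_derive x v (fun y => row_mx (A y) (B y)) (row_mx dA dB).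
Proof.
move=> hA hB; apply: is_derive_mx => i j; case: (split_ordP j) => k ->.
  rewrite row_mxEl (_ : (fun _ => _) = fun y => A y i k).
    exact: is_derive_mxE.
  by apply/funext => y; rewrite row_mxEl.
rewrite row_mxEr (_ : (fun _ => _) = fun y => B y i k).
  exact: is_derive_mxE.
by apply/funext => y; rewrite row_mxEr.
Qed.

Lemma differentiable_row_mx (R : realFieldType) (V : normedModType R)
    (m n1 n2 : nat) (A : V -> 'M[R]_(m, n1)) (B : V -> 'M[R]_(m, n2)) (x : V) :
  differentiable A x -> differentiable B x ->
  differentiable (fun y => row_mx (A y) (B y)) x.
Proof.
move=> hA hB; apply: differentiable_mx => i j; case: (split_ordP j) => k ->.
  rewrite (_ : (fun _ => _) = fun y => A y i k).
    exact: differentiable_mxE.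
  by apply/funext => y; rewrite row_mxEl.
rewrite (_ : (fun _ => _) = fun y => B y i k).
  exact: differentiable_mxE.
by apply/funext => y; rewrite row_mxEr.
Qed.

Lemma is_derive_lsubmx (R : numFieldType) (m n1 n2 : nat)
    (z v : 'M[R]_(m, n1 + n2)) : is_derive z v lsubmx (lsubmx v).
Proof.
have d := @differentiable_lsubmx R m n1 n2 z.
apply: DeriveDef; first exact: diff_derivable.
by rewrite deriveE // diff_lin //; exact: continuous_lsubmx.
Qed.

Lemma is_derive_rsubmx (R : numFieldType) (m n1 n2 : nat)
    (z v : 'M[R]_(m, n1 + n2)) : is_derive z v rsubmx (rsubmx v).
Proof.
have d := @differentiable_rsubmx R m n1 n2 z.
apply: DeriveDef; first exact: diff_derivable.
by rewrite deriveE // diff_lin //; exact: continuous_rsubmx.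
Qed.

(** The time coordinate passes through unchanged and does not mix with the coordinates of [M], hence
    the block-diagonal Jacobian. *)
Lemma line_chart_transition (R : realType) (n : nat) (T : topologicalType)
    (a b : chart R n T) (z : 'rV[R]_(1 + n)) :
  differentiable (cmap b \o cinv a) (rsubmx z) ->
  differentiable (cmap (line_chart b) \o cinv (line_chart a)) z /\
  'J (cmap (line_chart b) \o cinv (line_chart a)) z =
    block_mx 1%:M 0 0 ('J (cmap b \o cinv a) (rsubmx z)).
Proof.
move=> dT.
have -> : cmap (line_chart b) \o cinv (line_chart a) = fun y =>
    row_mx (lsubmx y) ((cmap b \o cinv a) (rsubmx y)).
  by apply/funext => y; rewrite /= -mx11_scalar.
have drs : differentiable (@rsubmx R 1 1 n) z by exact: differentiable_rsubmx.
have dls : differentiable (@lsubmx R 1 1 n) z by exact: differentiable_lsubmx.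
have dF := differentiable_row_mx dls (differentiable_comp drs dT).
split=> //; apply/row_matrixP => i; rewrite (row_jacobian i dF).
set e := delta_mx 0 i.
have dTe := is_derive_comp e drs dT.
rewrite (@derive_val _ _ _ _ _ _ _ (is_derive_rsubmx z e)) in dTe.
rewrite (@derive_val _ _ _ _ _ _ _
  (is_derive_row_mx (is_derive_lsubmx z e) dTe)).
rewrite rowE -/e -[e in RHS]hsubmxK mul_row_block mulmx1 !mulmx0 addr0 add0r.
by rewrite (deriveEjacobian _ dT).
Qed.

Lemma line_times_differentiable_atlas (R : realType) (n : nat)
    (M : chartedSpace R n) :
  differentiable_atlas M -> differentiable_atlas (line_times M).
Proof.
move=> [ch at_ tr]; split.
- by move=> _ [c ac <-]; apply: line_is_chart; exact: ch.
- move=> p; have [h1 h2] := at_ p.2; split=> //; by exists (chart_at p.2).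
- move=> _ _ [a ata <-] [b atb <-] [t x] /= ax bx.
  apply: (proj1 (@line_chart_transition _ _ _ a b _ _)).
  by rewrite row_mxKr; exact: tr.
Qed.

(** * The Levi-Civita derivative in a chart *)

Lemma innerE (R : realType) (n : nat) (A : 'M[R]_n) (v w : 'rV[R]_n) :
  inner A v w = \sum_i \sum_j v 0 i * A i j * w 0 j.
Proof.
rewrite /inner mxE exchange_big /=; apply: eq_bigr => j _.
by rewrite !mxE mulr_suml.
Qed.

Lemma inner_mulmx (R : realType) (m n : nat) (B : 'M[R]_(m, n)) (A : 'M[R]_n)
    (v w : 'rV[R]_m) : inner (B *m A *m B^T) v w = inner A (v *m B) (w *m B).
Proof. by rewrite /inner trmx_mul !mulmxA. Qed.

Lemma inner_sym (R : realType) (n : nat) (A : 'M[R]_n) (v w : 'rV[R]_n) :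
  A^T = A -> inner A v w = inner A w v.
Proof.
move=> Asym; rewrite /inner.
have -> : w *m A *m v^T = (v *m A *m w^T)^T.
  by rewrite !trmx_mul trmxK Asym mulmxA.
by rewrite [RHS]mxE.
Qed.

Lemma innerDl (R : realType) (n : nat) (A : 'M[R]_n) (v1 v2 w : 'rV[R]_n) :
  inner A (v1 + v2) w = inner A v1 w + inner A v2 w.
Proof. by rewrite /inner !mulmxDl mxE. Qed.

Lemma innerZl (R : realType) (n : nat) (A : 'M[R]_n) k (v w : 'rV[R]_n) :
  inner A (k *: v) w = k * inner A v w.
Proof. by rewrite /inner -!scalemxAl mxE. Qed.

Lemma innerZr (R : realType) (n : nat) (A : 'M[R]_n) k (v w : 'rV[R]_n) :
  inner A v (k *: w) = k * inner A v w.
Proof. by rewrite /inner linearZ /= -scalemxAr mxE. Qed.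

Lemma innerZm (R : realType) (n : nat) (A : 'M[R]_n) k (v w : 'rV[R]_n) :
  inner (k *: A) v w = k * inner A v w.
Proof. by rewrite /inner -scalemxAr -scalemxAl mxE. Qed.

Lemma derive_mx_basis (R : realType) (n p q : nat)
    (m : 'rV[R]_n -> 'M[R]_(p, q)) (x v : 'rV[R]_n) i j :
  differentiable m x ->
  ('D_v m x) i j =
  \sum_l v 0 l * 'D_(delta_mx 0 l) (fun y => m y i j : R^o) x.
Proof.
move=> dm; have dij := differentiable_mxE i j dm.
rewrite derive_mx ?mxE; last exact: diff_derivable.
rewrite (deriveE _ dij) [v in LHS]row_sum_delta linear_sum.
apply: eq_bigr => l _.
by rewrite linearZ (deriveE _ dij).
Qed.

(** Pairing with [E] through the metric cancels the inverse metric in the Christoffel symbols. Of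
    the three sums that remain, the first two agree after exchanging [i] and [j]; together they give
    the first term, and the third gives the second. *)
Lemma inner_christoffel (R : realType) (n : nat) (X : chartedSpace R n)
    (G : X -> 'M[R]_n) (c : chart R n X) (q V E : 'rV[R]_n) :
  let m := metric_in G c in
  (m q)^T = m q -> m q \in unitmx -> differentiable m q ->
  inner (m q)
    (\row_k \sum_i \sum_j christoffel G c q k i j * V 0 i * V 0 j) E =
  inner ('D_V m q) V E - 2^-1 * inner ('D_E m q) V V.
Proof.
move=> m msym munit dm.
pose pd l a b : R := 'D_(delta_mx 0 l) (fun y => m y a b : R^o) q.
pose C : 'rV[R]_n := \row_l \sum_i \sum_j
  (pd i j l + pd j i l - pd l i j) * V 0 i * V 0 j.
have -> : \row_k \sum_i \sum_j christoffel G c q k i j * V 0 i * V 0 j =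
    2^-1 *: (C *m invmx (m q)).
  apply/rowP => k; rewrite !mxE.
  under eq_bigr => i _ do under eq_bigr => j _ do
    rewrite /christoffel -!mulrA -/m mulr_suml.
  rewrite mulr_sumr.
  under [RHS]eq_bigr => l _.
    rewrite mxE mulr_suml mulr_sumr.
    under eq_bigr => i _ do rewrite mulr_suml mulr_sumr.
    over.
  rewrite [RHS]exchange_big; apply: eq_bigr => i _.
  rewrite [RHS]exchange_big; apply: eq_bigr => j _.
  rewrite mulr_sumr; apply: eq_bigr => l _.
  have -> : invmx (m q) l k = invmx (m q) k l.
    by rewrite -[in LHS]msym -trmx_inv mxE.
  by rewrite /pd; ring.
rewrite innerZl /inner mulmxKV //.
pose S := \sum_l \sum_i \sum_j pd i j l * V 0 i * V 0 j * E 0 l.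
pose S2 := \sum_l \sum_i \sum_j pd l i j * V 0 i * V 0 j * E 0 l.
have SE : inner ('D_V m q) V E = S.
  rewrite innerE exchange_big; apply: eq_bigr => l _; rewrite exchange_big.
  apply: eq_bigr => j _; rewrite (derive_mx_basis V j l dm) mulr_sumr mulr_suml.
  by apply: eq_bigr => i _; rewrite /pd; ring.
have SE2 : inner ('D_E m q) V V = S2.
  rewrite innerE [RHS]exchange_big; apply: eq_bigr => i _.
  rewrite [RHS]exchange_big; apply: eq_bigr => j _.
  rewrite (derive_mx_basis E i j dm) mulr_sumr mulr_suml.
  by apply: eq_bigr => l _; rewrite /pd; ring.
have SE3 : S = \sum_l \sum_i \sum_j pd j i l * V 0 i * V 0 j * E 0 l.
  apply: eq_bigr => l _; rewrite exchange_big.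
  do 2! (apply: eq_bigr => ? _).
  by rewrite -!mulrA; congr (_ * _); rewrite mulrCA.
have CE : (C *m E^T) 0 0 = S + S - S2.
  rewrite {2}SE3 -big_split -sumrB mxE; apply: eq_bigr => l _.
  rewrite !mxE mulr_suml -big_split -sumrB; apply: eq_bigr => i _.
  rewrite mulr_suml -big_split -sumrB; apply: eq_bigr => j _ /=.
  by rewrite !(mulrDl, mulNr).
suff key a b : a = S -> b = S2 -> 2^-1 * (C *m E^T) 0 0 = a - 2^-1 * b.
  exact: key SE SE2.
by move=> -> ->; rewrite CE; field.
Qed.

Lemma metric_in_cmap (R : realType) (n : nat) (X : chartedSpace R n)
    (G : X -> 'M[R]_n) (c : chart R n X) (x : X) (v w : 'rV[R]_n) :
  differentiable_atlas X -> atlas c -> cdom c x ->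
  inner (metric_in G c (cmap c x)) (v *m chart_jac c x) (w *m chart_jac c x) =
  inner (G x) v w.
Proof.
move=> dX ac cx; have [ch _ _] := dX; have [_ _ cK _ _] := ch _ ac.
rewrite /metric_in cK // inner_mulmx -!mulmxA.
by rewrite (chart_jacK dX ac cx) !mulmx1.
Qed.

Lemma metric_in_at (R : realType) (n : nat) (X : chartedSpace R n)
    (G : X -> 'M[R]_n) (x : X) :
  differentiable_atlas X ->
  metric_in G (chart_at x) (cmap (chart_at x) x) = G x.
Proof.
move=> dX; have [ch at_ _] := dX; have [ax xx] := at_ x.
have [_ _ cK _ _] := ch _ ax.
by rewrite /metric_in cK // chart_frame_at // mul1mx trmx1 mulmx1.
Qed.

(** * The second fundamental form through a normal field *)

Section SecondFundamentalForm.
Context (R : realType) (m n : nat).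
Context (X : chartedSpace R m) (Y : chartedSpace R n).
Context (G : Y -> 'M[R]_n) (f : X -> Y) (p : X).
Context (dX : differentiable_atlas X) (dY : differentiable_atlas Y).
Context (sf : smooth_map f).

Let phi := chart_at p.
Let c := chart_at (f p).
Let F := cmap c \o f \o cinv phi.
Let q0 := cmap phi p.

Lemma near_chart_map : \forall y \near cmap (chart_at p) p,
  [/\ cdom (chart_at (f p)) (f (cinv (chart_at p) y)),
      cdom (chart_at p) (cinv (chart_at p) y) &
      cmap (chart_at p) (cinv (chart_at p) y) = y].
Proof.
have [ch at_ _] := dX; have [ap pp] := at_ p.
have [chY atY _] := dY; have [afp fpp] := atY (f p).
have [oc _ _ _ _] := chY _ afp; have [cf _] := sf.
have U : nbhs p (f @^-1` cdom c) := cf _ _ (open_nbhs_nbhs (conj oc fpp)).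
exact: chart_near (ch _ ap) pp U.
Qed.

Lemma chart_map_at : F q0 = cmap c (f p).
Proof.
have [ch at_ _] := dX; have [ap pp] := at_ p.
by have [_ _ cK _ _] := ch _ ap; rewrite /F /q0 /= cK.
Qed.

Lemma near_chart_map_smooth (s : seq 'I_m) : \forall y \near q0,
  differentiable (foldr (fun i (h : 'rV[R]_m -> 'rV[R]_n) => fun y =>
    'D_(delta_mx 0 i) h y) F s) y.
Proof.
have [_ at_ _] := dX; have [ap pp] := at_ p.
have [_ atY _] := dY; have [afp fpp] := atY (f p).
have [_ df] := sf.
apply: filterS near_chart_map => y [h1 h2 h3]; apply: (df _ _ ap afp s).
by exists (cinv phi y).
Qed.

(** The pushed-forward field is a fixed combination of the first partial derivatives of [F], and
    these are differentiable because [f] is smooth. *)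
Lemma is_derive_push_forward (w : 'rV[R]_m) :
  is_derive q0 w (fun y => w *m 'J F y) ('D_w (fun y => w *m 'J F y) q0).
Proof.
apply: derivableP.
have : derivable (\sum_i (fun y => w 0 i *: 'D_(delta_mx 0 i) F y)) q0 w.
  apply: derivable_sum => i; apply: derivableZ; apply: diff_derivable.
  exact: nbhs_singleton (near_chart_map_smooth [:: i]).
apply: near_eq_derivable; apply: filterS (near_chart_map_smooth [::]) => y dFy.
rewrite fct_sumE mulmx_sum_row; apply: eq_bigr => i _.
by rewrite (row_jacobian i dFy).
Qed.

(** The field [extend p w] has constant components in [phi], so its image under the differential of
    [f], read in [c], is [w] times the Jacobian of [F]. This matches the field inside [sff] with a
    differentiable coordinate expression. *)
Lemma near_push_forward (w : 'rV[R]_m) : \forall y \near q0,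
  w *m 'J F y = extend p w (cinv phi y) *m tmap f (cinv phi y)
    *m chart_jac c (f (cinv phi y)).
Proof.
have [_ at_ _] := dX; have [ap pp] := at_ p.
have [_ atY _] := dY; have [afp fpp] := atY (f p).
apply: filterS near_chart_map => y [h1 h2 h3].
rewrite /extend -!mulmxA; congr (w *m _).
by rewrite mulmxA (tmap_in_charts dX dY sf ap afp h2 h1) h3.
Qed.

(** Differentiating the relation that tangent and normal fields are orthogonal trades the derivative
    of the tangent field for that of [E], at the cost of the metric derivative along [v] applied to
    [v] and [eta p]. The Christoffel term contains the same quantity, which cancels, and leaves half
    the metric derivative along [eta p]. *)
Lemma sff_normal_derivative (eta : X -> 'rV[R]_n) (w : 'rV[R]_m) :
  let E := fun y => eta (cinv phi y) *m chart_jac c (f (cinv phi y)) in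
  let v := w *m tmap f p in
  (G (f p))^T = G (f p) -> G (f p) \in unitmx ->
  differentiable (metric_in G c) (cmap c (f p)) -> differentiable E q0 ->
  (forall q z, inner (G (f q)) (z *m tmap f q) (eta q) = 0) ->
  sff G f p (eta p) w w =
    inner (G (f p)) v ('D_w E q0)
    + 2^-1 * inner ('D_(eta p) (metric_in G c) (cmap c (f p))) v v.
Proof.
move=> E v Gsym Gunit dG dE orth.
have [ch at_ _] := dX; have [ap pp] := at_ p; have [_ _ cK _ _] := ch _ ap.
have [chY atY _] := dY; have [afp fpp] := atY (f p).
have dF : differentiable F q0 := nbhs_singleton (near_chart_map_smooth [::]).
have DF : 'D_w F q0 = v by rewrite (deriveEjacobian _ dF).
have Eq0 : E q0 = eta p by rewrite /E /q0 cK // (chart_jac_at _ dY) mulmx1.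
set V := fun y => w *m 'J F y; set W := 'D_w V q0.
have hV : is_derive q0 w V W := is_derive_push_forward w.
have hE := diff_is_derive w dE.
have dG' : differentiable (metric_in G c) (F q0) by rewrite chart_map_at.
have hG := is_derive_comp w dF dG'; rewrite DF in hG.
have hI := is_derive_inner hG hV hE.
(* Near [q0] the product of the pushed-forward field with [E] is identically 0, so its product-rule
   derivative [hI] vanishes. *)
have hI0 : is_derive q0 w
    (fun y => inner ((metric_in G c \o F) y) (V y) (E y) : R^o) 0.
  apply: near_eq_is_derive (is_derive_cst (0 : R^o) q0 w).
  near=> y.
  have [h1 h2 h3] : [/\ cdom c (f (cinv phi y)), cdom phi (cinv phi y) &
      cmap phi (cinv phi y) = y] by near: y; exact: near_chart_map.
  have -> : V y = extend p w (cinv phi y) *m tmap f (cinv phi y)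
    *m chart_jac c (f (cinv phi y)) by near: y; exact: near_push_forward.
  by rewrite /= /E metric_in_cmap // orth.
have := @derive_val _ _ _ _ _ _ _ hI; rewrite (@derive_val _ _ _ _ _ _ _ hI0).
rewrite -(deriveE _ dE) Eq0.
have -> : (metric_in G c \o F) q0 = G (f p).
  by rewrite /= chart_map_at metric_in_at.
have -> : V q0 = v by [].
rewrite chart_map_at => sum0.
rewrite /sff /sff_fields.
set A := covd _ _ _ _ _.
(* In the chart at [f p] the covariant derivative is the componentwise derivative [W] plus the
   Christoffel term. *)
have -> : A = W + \row_k \sum_i \sum_j
    christoffel G c (cmap c (f p)) k i j * v 0 i * v 0 j.
  have dV : tderiv (fun q => extend p w q *m tmap f q *m chart_jac c (f q)) p w
      = W.
    by apply: near_eq_derive; apply: filterS (near_push_forward w) => y hy;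
      rewrite /V hy.
  have wE : extend p w p = w by rewrite /extend chart_frame_at // mulmx1.
  rewrite /A /covd wE -/c dV; apply/rowP => k.
  by rewrite [LHS]mxE [RHS]mxE [X in _ = _ + X]mxE.
have GE : metric_in G c (cmap c (f p)) = G (f p) by rewrite metric_in_at.
have := @inner_christoffel R n Y G c (cmap c (f p)) v (eta p).
rewrite /= GE => /(_ Gsym Gunit dG) chr.
rewrite innerDl chr.
lra.
Unshelve. all: by end_near. Qed.

End SecondFundamentalForm.

(** * Static metrics *)

Lemma inner_block_diag (R : realType) (n : nat) (a : R) (B : 'M[R]_n)
    (v w : 'rV[R]_(1 + n)) :
  inner (block_mx a%:M 0 0 B) v w =
  a * lsubmx v 0 0 * lsubmx w 0 0 + inner B (rsubmx v) (rsubmx w).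
Proof.
rewrite /inner -[v in LHS]hsubmxK -[w in LHS]hsubmxK mul_row_block.
rewrite !mulmx0 addr0 add0r tr_row_mx mul_row_col [LHS]mxE; congr (_ + _).
by rewrite mul_mx_scalar [LHS]mxE big_ord1 !mxE.
Qed.

(** A nonzero vector in the kernel would have inner product 0 with itself. *)
Lemma posdef_unitmx (R : realType) (n : nat) (A : 'M[R]_n) :
  (forall v : 'rV[R]_n, v != 0 -> 0 < inner A v v) -> A \in unitmx.
Proof.
move=> pA; rewrite -row_free_unit -kermx_eq0; apply/negPn/negP => kA.
have vA : nz_row (kermx A) *m A = 0.
  by apply/sub_kermxP; exact: nz_row_sub.
have := pA (nz_row (kermx A)); rewrite nz_row_eq0 => /(_ kA).
by rewrite /inner vA mul0mx mxE ltxx.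
Qed.

Lemma lorentzian_unitmx (R : realType) (n : nat) (A : 'M[R]_n) :
  is_lorentzian A -> A \in unitmx.
Proof.
case=> B Bu /(congr1 determinant); rewrite !det_mulmx det_tr det_diag => dE.
have : \prod_(i < n) (\row_(i < n) (if i == 0%N :> nat then -1 else 1 : R)) 0 i
    != 0.
  apply/prodf_neq0 => i _; rewrite mxE; case: ifP => _; rewrite ?oppr_eq0;
    exact: oner_neq0.
rewrite -dE !mulf_eq0 !negb_or -unitfE => /andP[/andP[_ dA] _].
by rewrite unitmxE unitfE.
Qed.

(* The row space of T and the orthogonal complement of e both have dimension n. *)
Lemma orthogonal_submx (R : realType) (n : nat) (A : 'M[R]_(1 + n))
    (T : 'M[R]_(n, 1 + n)) (e z : 'rV[R]_(1 + n)) :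
  A \in unitmx -> row_free T -> e != 0 ->
  (forall w : 'rV[R]_n, inner A (w *m T) e = 0) -> inner A z e = 0 ->
  exists w : 'rV[R]_n, w *m T = z.
Proof.
move=> Au Tfree e0 Te ze; set k := A *m e^T.
have Tk : (T <= kermx k)%MS.
  apply/sub_kermxP/row_matrixP => i; rewrite row_mul row0.
  apply/rowP => j; rewrite (ord1 j) [RHS]mxE.
  by have := Te (delta_mx 0 i); rewrite /inner -rowE /k mulmxA.
have rk : \rank k = 1%N.
  by rewrite /k (eqmxMfull _ _) ?mxrank_tr ?rank_rV ?e0 // row_full_unit.
have kT : (kermx k <= T)%MS.
  have := mxrank_leqif_eq Tk; case=> _; rewrite mxrank_ker rk (eqP Tfree).
  by rewrite addKn eqxx => /esym/andP[].
have zk : (z <= kermx k)%MS.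
  apply/sub_kermxP/matrixP => i j; rewrite (ord1 i) (ord1 j) /k mulmxA.
  by rewrite [RHS]mxE.
by have /submxP[w ->] := submx_trans zk kT; exists w.
Qed.

Lemma chart_frame_line (R : realType) (n : nat) (M : chartedSpace R n)
    (c : chart R n M) (r : line_times M) :
  differentiable_atlas M -> atlas c -> cdom c (space_of r) ->
  chart_frame (line_chart c : chart R (1 + n) (line_times M)) r =
  block_mx 1%:M 0 0 (chart_frame c (space_of r)).
Proof.
move=> [ch at_ tr] ac cr; have [ar rr] := at_ (space_of r).
have := @line_chart_transition _ _ _ c (chart_at (space_of r))
  (cmap (line_chart c) r).
by rewrite row_mxKr => /(_ (tr _ _ ac ar _ cr rr)) [].
Qed.

Lemma chart_jac_line (R : realType) (n : nat) (M : chartedSpace R n)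
    (c : chart R n M) (r : line_times M) :
  differentiable_atlas M -> atlas c -> cdom c (space_of r) ->
  chart_jac (line_chart c : chart R (1 + n) (line_times M)) r =
  block_mx 1%:M 0 0 (chart_jac c (space_of r)).
Proof.
move=> [ch at_ tr] ac cr; have [ar rr] := at_ (space_of r).
have := @line_chart_transition _ _ _ (chart_at (space_of r)) c
  (cmap (line_chart (chart_at (space_of r))) r).
by rewrite row_mxKr => /(_ (tr _ _ ar ac _ rr cr)) [].
Qed.

Lemma static_metric_in (R : realType) (n : nat) (M : chartedSpace R n)
    (g : M -> 'M[R]_n) (N : M -> R) (c : chart R n M) (z : 'rV[R]_(1 + n)) :
  differentiable_atlas M -> atlas c -> (cmap c @` cdom c) (rsubmx z) ->
  metric_in (static_metric g N)
    (line_chart c : chart R (1 + n) (line_times M)) z =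
  block_mx (- N (cinv c (rsubmx z)) ^+ 2)%:M 0 0 (metric_in g c (rsubmx z)).
Proof.
move=> dM ac [x cx xz]; have [ch _ _] := dM; have [_ _ cK _ _] := ch _ ac.
have xE : cinv c (rsubmx z) = x by rewrite -xz cK.
rewrite /metric_in chart_frame_line //=; last by rewrite xE.
rewrite /static_metric /space_of /= tr_block_mx !mulmx_block !trmx1 !trmx0.
by rewrite !(mulmx0, mul0mx, addr0, add0r, mulmx1, mul1mx).
Qed.

Lemma static_metric_sym (R : realType) (n : nat) (M : chartedSpace R n)
    (g : M -> 'M[R]_n) (N : M -> R) (r : line_times M) :
  (forall x, (g x)^T = g x) ->
  (static_metric g N r)^T = static_metric g N r.
Proof.
by move=> gs; rewrite /static_metric tr_block_mx gs tr_scalar_mx !trmx0.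
Qed.

Lemma static_metric_unitmx (R : realType) (n : nat) (M : chartedSpace R n)
    (g : M -> 'M[R]_n) (N : M -> R) (r : line_times M) :
  N (space_of r) != 0 -> g (space_of r) \in unitmx ->
  static_metric g N r \in unitmx.
Proof.
move=> N0 gu; rewrite unitmxE /static_metric det_ublock det_scalar unitrM.
by rewrite -unitmxE gu andbT expr1 unitfE oppr_eq0 expf_eq0 negb_and N0 orbT.
Qed.

Lemma differentiable_block_diag (R : realFieldType) (V : normedModType R)
    (m1 m2 n1 n2 : nat) (A : V -> 'M[R]_(m1, n1)) (B : V -> 'M[R]_(m2, n2)) x :
  differentiable A x -> differentiable B x ->
  differentiable (fun y => block_mx (A y) 0 0 (B y)) x.
Proof.
move=> hA hB; apply: differentiable_mx => i j.
case: (split_ordP i) => i' ->; case: (split_ordP j) => j' ->.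
- rewrite (_ : (fun _ => _) = fun y => A y i' j').
    exact: differentiable_mxE.
  by apply/funext => y; rewrite block_mxEul.
- rewrite (_ : (fun _ => _) = cst 0); first exact: differentiable_cst.
  by apply/funext => y; rewrite block_mxEur mxE.
- rewrite (_ : (fun _ => _) = cst 0); first exact: differentiable_cst.
  by apply/funext => y; rewrite block_mxEdl mxE.
- rewrite (_ : (fun _ => _) = fun y => B y i' j').
    exact: differentiable_mxE.
  by apply/funext => y; rewrite block_mxEdr.
Qed.

Lemma is_derive_block_diag (R : realFieldType) (V : normedModType R)
    (m1 m2 n1 n2 : nat) (A : V -> 'M[R]_(m1, n1)) (B : V -> 'M[R]_(m2, n2))
    dA dB (x v : V) :
  is_derive x v A dA -> is_derive x v B dB ->
  is_derive x v (fun y => block_mx (A y) 0 0 (B y)) (block_mx dA 0 0 dB).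
Proof.
move=> hA hB; apply: is_derive_mx => i j.
case: (split_ordP i) => i' ->; case: (split_ordP j) => j' ->.
- rewrite block_mxEul (_ : (fun _ => _) = fun y => A y i' j').
    exact: is_derive_mxE.
  by apply/funext => y; rewrite block_mxEul.
- rewrite block_mxEur mxE (_ : (fun _ => _) = cst 0).
    exact: is_derive_cst.
  by apply/funext => y; rewrite block_mxEur mxE.
- rewrite block_mxEdl mxE (_ : (fun _ => _) = cst 0).
    exact: is_derive_cst.
  by apply/funext => y; rewrite block_mxEdl mxE.
- rewrite block_mxEdr (_ : (fun _ => _) = fun y => B y i' j').
    exact: is_derive_mxE.
  by apply/funext => y; rewrite block_mxEdr.
Qed.

(** Contracting a multiple of the metric with the inverse metric gives that multiple of the
    identity, whose trace carries the dimension [m]. *)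
Lemma umbilic_mean_curvature (R : realType) (m n : nat)
    (X : chartedSpace R m) (Y : chartedSpace R n) (G : Y -> 'M[R]_n)
    (f : X -> Y) (p : X) (e : 'rV[R]_n) (lambda : R) :
  induced_metric G f p \in unitmx ->
  (forall v w, sff G f p e v w = lambda * inner (induced_metric G f p) v w) ->
  mean_curvature G f p e = m%:R * lambda.
Proof.
move=> Iu um; rewrite /mean_curvature.
have -> : \matrix_(i < m, j < m) sff G f p e (delta_mx 0 i) (delta_mx 0 j) =
    lambda *: induced_metric G f p.
  apply/matrixP => i j; rewrite !mxE um; congr (_ * _).
  by rewrite /inner -rowE trmx_delta -colE !mxE.
by rewrite -scalemxAr mulVmx // scalemx1 mxtrace_scalar mulr_natl.
Qed.

(** * First derivatives of a static metric in a chart *)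

Section StaticSpacetime.
Context (R : realType) (n : nat) (M : chartedSpace R n) (g : M -> 'M[R]_n).
Context (N : M -> R) (st : static_spacetime g N).

Let dM : differentiable_atlas M.
Proof. by case: st => /manifold_differentiable_atlas. Qed.

Let dL : differentiable_atlas (line_times M).
Proof. exact: line_times_differentiable_atlas. Qed.

Lemma static_differentiable_potential (x : M) :
  differentiable (N \o cinv (chart_at x) : 'rV[R]_n -> R^o)
    (cmap (chart_at x) x).
Proof.
have [_ _ sN _] := st; have [_ at_ _] := dM; have [ax xx] := at_ x.
by apply: (sN _ ax [::]); exists x.
Qed.

Lemma static_differentiable_metric (x : M) :
  differentiable (metric_in g (chart_at x)) (cmap (chart_at x) x).
Proof.
have [_ [_ _ sg] _ _] := st; have [_ at_ _] := dM; have [ax xx] := at_ x.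
by apply: differentiable_mx => i j; apply: (sg _ i j ax [::]); exists x.
Qed.

Lemma near_static_metric_in (r : line_times M) :
  {near cmap (chart_at r) r,
    (fun z => block_mx (- N (cinv (chart_at (space_of r)) (rsubmx z)) ^+ 2)%:M
       0 0 (metric_in g (chart_at (space_of r)) (rsubmx z)))
    =1 metric_in (static_metric g N) (chart_at r)}.
Proof.
have [chL atL _] := dL; have [ar rr] := atL r.
have [ch at_ _] := dM; have [arr rrr] := at_ (space_of r).
have [_ oI _ _ _] := chL _ ar.
have : nbhs (cmap (chart_at r) r) (cmap (chart_at r) @` cdom (chart_at r)).
  by apply: open_nbhs_nbhs; split=> //; exists r.
apply: filterS => _ [y yr <-]; rewrite static_metric_in // row_mxKr.
by exists (space_of y).
Qed.

Lemma is_derive_static_metric_in (r : line_times M) (e : 'rV[R]_(1 + n)) :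
  let x := space_of r in
  differentiable (metric_in (static_metric g N) (chart_at r))
    (cmap (chart_at r) r) /\
  'D_e (metric_in (static_metric g N) (chart_at r)) (cmap (chart_at r) r) =
  block_mx (- (2 * N x * tderiv (N : M -> R^o) x (rsubmx e)))%:M 0 0
    ('D_(rsubmx e) (metric_in g (chart_at x)) (cmap (chart_at x) x)).
Proof.
move=> x; have nE := near_static_metric_in r.
set z0 := cmap (chart_at r) r.
have rz0 : rsubmx z0 = cmap (chart_at x) x by rewrite /z0 row_mxKr.
have [ch at_ _] := dM; have [ax xx] := at_ x; have [_ _ cK _ _] := ch _ ax.
have drs : differentiable (@rsubmx R 1 1 n) z0 by exact: differentiable_rsubmx.
have dN : differentiable (N \o cinv (chart_at x) : 'rV[R]_n -> R^o) (rsubmx z0).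
  by rewrite rz0; exact: static_differentiable_potential.
have dg : differentiable (metric_in g (chart_at x)) (rsubmx z0).
  by rewrite rz0; exact: static_differentiable_metric.
have Dr := @derive_val _ _ _ _ _ _ _ (is_derive_rsubmx z0 e).
have hN := is_derive_comp e drs dN; rewrite Dr rz0 in hN.
have hg := is_derive_comp e drs dg; rewrite Dr rz0 in hg.
have dA : differentiable (fun z : 'rV[R]_(1 + n) =>
    (- N (cinv (chart_at x) (rsubmx z)) ^+ 2)%:M : 'M[R]_1) z0.
  apply: differentiable_mx => i j; rewrite (ord1 i) (ord1 j).
  rewrite (_ : (fun _ => _) =
    - (((N \o cinv (chart_at x)) \o rsubmx) ^+ 2 : 'rV[R]_(1 + n) -> R^o)).
    apply: differentiableN; apply: differentiableX.
    exact: differentiable_comp.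
  by apply/funext => z; rewrite mxE eqxx mulr1n.
have hA : is_derive z0 e (fun z : 'rV[R]_(1 + n) =>
    (- N (cinv (chart_at x) (rsubmx z)) ^+ 2)%:M : 'M[R]_1)
    (- (2 * N x * tderiv (N : M -> R^o) x (rsubmx e)))%:M.
  apply: is_derive_mx => i j; rewrite (ord1 i) (ord1 j) mxE eqxx mulr1n.
  rewrite (_ : (fun _ => _) =
    - (((N \o cinv (chart_at x)) \o rsubmx) ^+ 2 : 'rV[R]_(1 + n) -> R^o)).
    have hX := is_deriveX 2 hN.
    apply: (is_derive_eq (is_deriveN hX)).
    by rewrite /= rz0 cK // expr1 /GRing.scale /= -mulr_natl.
  by apply/funext => z; rewrite mxE eqxx mulr1n.
have dB := differentiable_block_diag dA (differentiable_comp drs dg).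
split; first exact: near_eq_differentiable nE dB.
rewrite -(near_eq_derive e nE).
exact: (@derive_val _ _ _ _ _ _ _ (is_derive_block_diag hA hg)).
Qed.

End StaticSpacetime.

(** * Derivatives along lines and the second fundamental form in the direction Z *)

Lemma is_derive_lineP (R : numFieldType) (V W : normedModType R) (f : V -> W)
    (x v : V) df :
  is_derive x v f df <-> is_derive (0 : R) 1 (fun r : R => f (r *: v + x)) df.
Proof.
have E : 'D_v f x = 'D_1 (fun r : R => f (r *: v + x)) 0.
  rewrite /derive; set a := fun r => r^-1 *: _; set b := fun r => r^-1 *: _.
  suff -> : a = b by [].
  by apply/funext => r; rewrite /a /b /= addr0 scale0r add0r [_%:A]mulr1.
by split=> -[d <-]; [exact: DeriveDef ((derivable1P f x v).1 d) (esym E)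
  |exact: DeriveDef ((derivable1P f x v).2 d) E].
Qed.

(** Restricting to the line through [x] with direction [v] reduces the claim to the one-variable
    derivative of the square root. *)
Lemma is_derive_sqrt (R : realType) (V : normedModType R) (S : V -> R^o)
    (dS : R) (x v : V) : is_derive x v S dS -> 0 < S x ->
  is_derive x v (fun y => Num.sqrt (S y) : R^o) (dS / (2 * Num.sqrt (S x))).
Proof.
move=> /is_derive_lineP hS S0; apply/is_derive_lineP.
set T := fun r : R => S (r *: v + x) in hS *.
have T0 : T 0 = S x by rewrite /T scale0r add0r.
have [dT DT] := hS; have dT' : differentiable T 0 by apply/derivable1_diffP.
have [dsq vsq] := is_derive1_sqrt S0.
have dsq' : differentiable (Num.sqrt : R^o -> R^o) (T 0).
  by rewrite T0; apply/derivable1_diffP.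
have h := is_derive_comp (1 : R^o) dT' dsq'; apply: (is_derive_eq h).
rewrite DT (deriveE _ dsq') -[dS]mulr1 linearZ /= -(deriveE _ dsq').
by rewrite T0 vsq mulr1.
Qed.

(** Let [l] be the time component of [E] and [eps] its spatial part. Then [l = s h / N^2] and
    [eps = s nu], so [s] is the length of [eps], and [h = l N^2 / s] inherits differentiability.
    Differentiating [l N^2 = s h] expresses the derivative of [l] in [sff_normal_derivative] through
    that of [h]. *)
Lemma static_sff (R : realType) (n : nat) (M : chartedSpace R n)
    (g : M -> 'M[R]_n) (N : M -> R) (P : chartedSpace R n)
    (f : P -> line_times M) (eta : P -> 'rV[R]_(1 + n)) (nu : P -> 'rV[R]_n)
    (s h : P -> R) (p : P) (w : 'rV[R]_n) :
  let G := static_metric g N in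
  let x := space_of (f p) in
  let nuN : R := tderiv (N : M -> R^o) x (nu p) in
  static_spacetime g N -> differentiable_atlas P -> smooth_map f ->
  smooth_field_along f eta ->
  (forall q z, inner (G (f q)) (z *m tmap f q) (eta q) = 0) ->
  (forall q, inner (g (space_of (f q))) (nu q) (nu q) = 1) ->
  (forall q, 0 < s q) ->
  (forall q, eta q = s q *:
     (horizontal (nu q) + (h q / N (space_of (f q)) ^+ 2) *: ddt R n)) ->
  w *m tmap f p = ddt R n + h p *: horizontal (nu p) ->
  derivable (h \o cinv (chart_at p) : 'rV[R]_n -> R^o)
    (cmap (chart_at p) p) w /\
  sff G f p (eta p) w w =
    - (s p * tderiv (h : P -> R^o) p w)
    + 2 * s p * h p ^+ 2 * nuN / N x - N x * s p * nuN.
Proof.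
move=> G x nuN st dP sf seta orth nu1 s0 etaE wZ.
have dM : differentiable_atlas M by case: st => /manifold_differentiable_atlas.
have dL := line_times_differentiable_atlas dM.
have [mM [gsym gpos gsm] sN N0] := st.
have [ch at_ _] := dM; have [ax xx] := at_ x; have [_ _ cK _ _] := ch _ ax.
have [chP atP _] := dP; have [ap pp] := atP p; have [_ _ cPK _ _] := chP _ ap.
have [chL atL _] := dL; have [afp fpp] := atL (f p).
set phi := chart_at p; set q0 := cmap phi p; set psi := chart_at x.
pose c : chart R (1 + n) (line_times M) := chart_at (f p).
pose F := cmap c \o f \o cinv phi.
pose E := fun y => eta (cinv phi y) *m chart_jac c (f (cinv phi y)).
have dE : differentiable E q0 by apply: (seta _ _ ap afp [::]); exists p.
have dF : differentiable F q0.
  exact: nbhs_singleton (near_chart_map_smooth p dP dL sf [::]).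
have Fq0 : F q0 = cmap c (f p) by exact: chart_map_at.
have rFq0 : rsubmx (F q0) = cmap psi x by rewrite Fq0 row_mxKr.
have DF : 'D_w F q0 = ddt R n + h p *: horizontal (nu p).
  by rewrite (deriveEjacobian _ dF) -wZ.
have Eq0 : E q0 = eta p by rewrite /E /q0 cPK // (chart_jac_at _ dL) mulmx1.
have [dGm DGm] := is_derive_static_metric_in st (f p) (eta p).
have Gu : G (f p) \in unitmx.
  apply: static_metric_unitmx; first by rewrite gt_eqF.
  by apply: posdef_unitmx; exact: gpos.
have := sff_normal_derivative dP dL sf w (static_metric_sym N (f p) gsym) Gu dGm
  dE orth.
rewrite /= -/G wZ => ->.
pose E' := 'D_w E q0; rewrite -/q0 -/phi -[X in inner _ _ X]/E'.
have hE : is_derive q0 w E E' by apply: derivableP; exact: diff_derivable.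
(* The index of the time coordinate. *)
pose i0 : 'I_(1 + n) := lshift n 0.
have hl : is_derive q0 w (fun y => E y 0 i0 : R^o) (E' 0 i0).
  exact: is_derive_mxE 0 i0 hE.
have heps : is_derive q0 w (rsubmx \o E) (rsubmx E').
  have := is_derive_comp w dE (differentiable_rsubmx (E q0)).
  by rewrite (@derive_val _ _ _ _ _ _ _ (is_derive_rsubmx _ _)).
have drF : differentiable (rsubmx \o F) q0.
  by apply: differentiable_comp dF _; exact: differentiable_rsubmx.
have DrF : 'D_w (rsubmx \o F) q0 = h p *: nu p.
  have [_ ->] := is_derive_comp w dF (differentiable_rsubmx (F q0)).
  rewrite (@derive_val _ _ _ _ _ _ _ (is_derive_rsubmx _ _)) DF.
  by rewrite linearD /= linearZ /= /ddt /horizontal !row_mxKr add0r.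
have dg : differentiable (metric_in g psi) (cmap psi x).
  exact: static_differentiable_metric st x.
have dN : differentiable (N \o cinv psi : _ -> R^o) (cmap psi x).
  exact: static_differentiable_potential st x.
(* The coefficients of [g] and the potential do not depend on time, so along Z only its spatial part
   [h nu] differentiates them. *)
have hK : is_derive q0 w (metric_in g psi \o (rsubmx \o F))
    (h p *: 'D_(nu p) (metric_in g psi) (cmap psi x)).
  have dgF : differentiable (metric_in g psi) ((rsubmx \o F) q0).
    by rewrite /= rFq0.
  apply: (is_derive_eq (is_derive_comp w drF dgF)).
  by rewrite DrF /= rFq0 !(deriveE _ dg) linearZ.
pose U y : R^o := (N \o cinv psi) ((rsubmx \o F) y).
have hU : is_derive q0 w U (h p * nuN).
  have dNF : differentiable (N \o cinv psi : _ -> R^o) ((rsubmx \o F) q0).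
    by rewrite /= rFq0.
  apply: (is_derive_eq (is_derive_comp w drF dNF)).
  by rewrite DrF /= rFq0 /nuN /tderiv !(deriveE _ dN) linearZ.
(* The squared length of the spatial part of [E]; it equals [s^2] because [nu] is a unit vector. *)
pose S y : R^o := inner ((metric_in g psi \o (rsubmx \o F)) y)
  ((rsubmx \o E) y) ((rsubmx \o E) y).
have hS := is_derive_inner hK heps heps; rewrite -/S in hS.
have nearE : \forall y \near q0, [/\ E y 0 i0 = s (cinv phi y) *
    (h (cinv phi y) / U y ^+ 2), S y = s (cinv phi y) ^+ 2 & 0 < U y].
  apply: filterS (near_chart_map p dP dL sf) => y [h1 h2 h3].
  set q := cinv phi y in h2 h3 *.
  have Uy : U y = N (space_of (f q)).
    rewrite /U /F /= row_mxKr; have [_ _ -> //] := ch _ ax.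
  have EE : E y = s q *: row_mx (h q / U y ^+ 2)%:M
      (nu q *m chart_jac psi (space_of (f q))).
    rewrite /E etaE Uy -scalemxAl; congr (_ *: _).
    rewrite /c chart_jac_line // /ddt /horizontal scale_row_mx scaler0.
    rewrite add_row_mx add0r addr0 mul_row_block !mulmx0 mulmx1 addr0 add0r.
    by rewrite scalemx1.
  split.
  - by rewrite EE mxE row_mxEl mxE eqxx mulr1n.
  - rewrite /S /= EE linearZ /= row_mxKr innerZl innerZr mulrA -expr2.
    have -> : rsubmx (F y) = cmap psi (space_of (f q)).
      by rewrite /F /= row_mxKr.
    by rewrite metric_in_cmap // nu1 mulr1.
  - by rewrite Uy N0.
have [El0 ES0 U0] := nbhs_singleton nearE.
have Sgt0 : 0 < S q0 by rewrite ES0 exprn_gt0.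
have hsq := is_derive_sqrt hS Sgt0.
have cp : cinv phi q0 = p by rewrite /q0 cPK.
have Uq0 : U q0 = N x by rewrite /U /= rFq0 cK.
rewrite cp Uq0 in El0; rewrite cp in ES0.
set sq := fun y => Num.sqrt (S y) : R^o in hsq.
have sqE y : S y = s (cinv phi y) ^+ 2 -> sq y = s (cinv phi y).
  by move=> Sy; rewrite /sq Sy sqrtr_sqr gtr0_norm.
have sq0 : sq q0 = s p by rewrite sqE cp.
have dh : derivable (h \o cinv phi : _ -> R^o) q0 w.
  have : derivable ((fun y => E y 0 i0 : R^o) * U ^+ 2 * (fun y => (sq y)^-1))
      q0 w.
    apply: derivableM; last first.
      by apply: derivableV; [rewrite sq0 gt_eqF|case: hsq].
    apply: derivableM; first by case: hl.
    by apply: derivableX; case: hU.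
  apply: near_eq_derivable; apply: filterS nearE => y [E1 E2 E3] /=.
  rewrite !fctE E1 (sqE _ E2).
  by field; rewrite !gt_eqF.
split=> //.
have hh := derivableP dh.
have h1 := is_deriveM hl (is_deriveX 2 hU).
have h2 := is_deriveM hsq hh.
(* The identity [l N^2 = s h], with [s] written as the square root of [S]; equating the product-rule
   derivatives of its two sides gives [rel]. *)
have h12 : \near q0, ((fun y => E y 0 i0 : R^o) * U ^+ 2) q0 =
    (sq * (h \o cinv phi : _ -> R^o)) q0.
  apply: filterS nearE => y [E1 E2 E3] /=.
  rewrite !fctE E1 (sqE _ E2).
  by field; rewrite !gt_eqF.
have := near_eq_derive w h12.
rewrite (@derive_val _ _ _ _ _ _ _ h1) (@derive_val _ _ _ _ _ _ _ h2).
rewrite -/(tderiv (h : P -> R^o) p w).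
have reta : rsubmx (eta p) = s p *: nu p.
  by rewrite etaE linearZ linearD /= linearZ /= !row_mxKr scaler0 addr0.
have lZ : lsubmx (ddt R n + h p *: horizontal (nu p)) 0 0 = 1.
  by rewrite linearD /= linearZ /= !row_mxKl scaler0 addr0 mxE eqxx.
have rZ : rsubmx (ddt R n + h p *: horizontal (nu p)) = h p *: nu p.
  by rewrite linearD /= linearZ /= !row_mxKr add0r.
have repsq0 : (rsubmx \o E) q0 = s p *: nu p by rewrite -reta -Eq0.
have Kq0 : (metric_in g psi \o (rsubmx \o F)) q0 = g x.
  by rewrite /= rFq0 metric_in_at.
have lE : lsubmx E' 0 0 = E' 0 i0 by rewrite mxE.
(* [kappa] comes from differentiating the coefficients of [g] along [nu], and [gamma] from
   differentiating the spatial part of [E]. *)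
pose kappa := inner ('D_(nu p) (metric_in g psi) (cmap psi x)) (nu p) (nu p).
pose gamma := inner (g x) (nu p) (rsubmx E').
rewrite DGm /G /static_metric !inner_block_diag lZ rZ lE reta repsq0 Kq0.
rewrite -/x -/psi -/nuN.
have -> : tderiv (N : M -> R^o) x (s p *: nu p) = s p * nuN.
  by rewrite /nuN /tderiv !(deriveE _ dN) linearZ.
have -> : 'D_(s p *: nu p) (metric_in g psi) (cmap psi x) =
    s p *: 'D_(nu p) (metric_in g psi) (cmap psi x).
  by rewrite !(deriveE _ dg) linearZ.
rewrite (inner_sym (rsubmx E') _ (gsym x)).
rewrite !(innerZm, innerZl, innerZr) -/kappa -/gamma fctE Uq0 El0 /= cp sq0.
have -> : Num.sqrt (S q0) = s p by rewrite -sq0.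
move: (tderiv _ p w) (E' 0 i0) (N0 x) (s0 p) => h' l'.
rewrite /GRing.scale /= -/h => Nx0 sp0 rel.
have Nx0' : N x != 0 by rewrite gt_eqF.
have sp0' : s p != 0 by rewrite gt_eqF.
(* The bracket [h s kappa / 2 + gamma] is the derivative of [s]. In the second fundamental form
   [kappa] and [gamma] occur with the opposite coefficients, so substituting [rel] removes both. *)
have {}rel : N x ^+ 2 * l' = s p * h' + h p * (h p * s p * kappa / 2 + gamma)
    - 2 * s p * h p ^+ 2 * nuN / N x.
  apply/eqP; rewrite eq_sym subr_eq; apply/eqP; rewrite addrC.
  transitivity (s p * (h p / N x ^+ 2) * (2 * N x ^+ 1 * (h p * nuN))
    + N x ^+ 2 * l'); last by field.
  by rewrite [RHS]rel; field.
rewrite [X in X = _](_ : _ = - (N x ^+ 2 * l') + h p * gamma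
   - s p * N x * nuN + 2^-1 * (h p ^+ 2 * s p * kappa)); last by field.
by rewrite rel; field.
Qed.

(** * Accumulating zeros *)

Lemma cvg_growth_rate0 (R : realType) (f : R -> R^o) : derivable f 0 1 ->
  (fun r : R => r^-1 * (f r - f 0)) @ 0^' --> ('D_1 f 0 : R).
Proof.
move=> df.
have h : (fun r : R => r^-1 *: ((f \o shift 0) (r *: (1 : R)) - f 0)) @ 0^'
    --> 'D_1 f 0 := df.
suff -> : (fun r : R => r^-1 * (f r - f 0)) =
  (fun r : R => r^-1 *: ((f \o shift 0) (r *: (1 : R)) - f 0)) by exact: h.
by apply/funext => r; rewrite /= addr0 [_%:A]mulr1.
Qed.

(** Since [T] has derivative 1 at 0, it passes strictly from below [T 0] to above it on every small
    interval around 0. Some [t_ i] lies between the end values, and the intermediate value theorem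
    yields a time-[t_ i] point, where [H] vanishes; it is not 0 because [t_ i] differs from [T 0].
    So the zeros of [H] accumulate at 0. *)
Lemma derive_eq0_of_accumulating_zeros (R : realType) (T H : R -> R^o)
    (t_ : nat -> R) :
  is_derive (0 : R) (1 : R) T 1 ->
  (\forall r \near (0 : R), {for r, continuous T}) ->
  derivable H 0 1 ->
  cluster (t_ @ \oo) (T 0) -> (forall i, t_ i <> T 0) ->
  (forall i r, T r = t_ i -> H r = 0) ->
  H 0 = 0 /\ 'D_1 H 0 = 0.
Proof.
move=> [dT DT] cT dH clT tT TH.
have zeros (A : set R) : nbhs (0 : R) A -> exists r, [/\ r != 0, A r & H r = 0].
  move=> A0.
  have Tpos : \forall r \near (0 : R)^', 0 < r^-1 * (T r - T 0).
    by have := cvg_growth_rate0 dT; rewrite DT => /cvgr_gt; apply.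
  have : \forall r \near (0 : R), [/\ A r, {for r, continuous T} &
      r != 0 -> 0 < r^-1 * (T r - T 0)].
    by apply: filterS3 A0 cT Tpos => r ? ? h; split.
  move=> /nbhs_ballP[d /= d0 hd].
  (* Halving keeps the closed interval from [- e] to [e] inside the open ball of radius [d]. *)
  pose e := d / 2.
  have e0 : 0 < e by rewrite divr_gt0.
  have inball r : - e <= r <= e -> ball (0 : R) d r.
    move=> /andP[r1 r2]; rewrite /ball /= sub0r normrN ltr_norml.
    by apply/andP; split; [apply: lt_le_trans r1|apply: le_lt_trans r2 _];
      rewrite /e; lra.
  have Te : T 0 < T e.
    have [|_ _ /(_ (lt0r_neq0 e0))] := hd e (inball e _); first by lra.
    by rewrite pmulr_rgt0 ?invr_gt0 // subr_gt0.
  have TNe : T (- e) < T 0.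
    have [|_ _] := hd (- e) (inball (- e) _); first by lra.
    rewrite oppr_eq0 => /(_ (lt0r_neq0 e0)).
    by rewrite nmulr_rgt0 ?subr_lt0 // invr_lt0 oppr_lt0.
  have [t [[i _ <-]]] : (range t_ `&` `]T (- e), T e[%classic) !=set0.
    apply: clT; first by exists 0%N => // i _; exists i.
    apply: open_nbhs_nbhs; split; first exact: interval_open.
    by rewrite /= in_itv /= TNe.
  rewrite /= in_itv /= => /andP[ti1 ti2].
  have [] := @IVT _ T (- e) e (t_ i).
  - lra.
  - apply: continuous_in_subspaceT => r; rewrite inE /= in_itv /= => re.
    by have [] := hd r (inball r re).
  - by rewrite ge_min le_max (ltW ti1) (ltW ti2) orbT.
  - move=> r; rewrite in_itv /= => re Tr; exists r; split.
    + by apply/eqP => r0; apply: (tT i); rewrite -Tr r0.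
    + by have [] := hd r (inball r re).
    + exact: TH Tr.
have cH : H @ (0 : R) --> H 0.
  by apply: differentiable_continuous; apply/derivable1_diffP.
have H0 : H 0 = 0.
  apply/eqP/negPn/negP => H0.
  have [r [_ Hr /eqP]] := zeros _ (cvgr_neq0 _ cH H0).
  by rewrite (negbTE Hr).
split=> //; apply/eqP/negPn/negP => D0.
(* A nonzero derivative would keep the difference quotients away from 0 near 0, yet they vanish at
   the zeros of [H] since [H 0 = 0]. *)
have nz : \forall r \near (0 : R)^', r^-1 * (H r - H 0) != 0.
  exact: cvgr_neq0 _ (cvg_growth_rate0 dH) D0.
have [r [r0 + Hr]] := zeros _ nz.
by move=> /(_ r0); rewrite Hr H0 subrr mulr0 eqxx.
Qed.

(** * Slice values and the mean curvature formula *)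

Lemma slice_value_time_of (R : realType) (n : nat) (M : chartedSpace R n)
    (N : M -> R) (P : chartedSpace R n) (f : P -> line_times M) (p : P) :
  equipotential N f -> slice_value N f (time_of (f p)) = N (space_of (f p)).
Proof.
move=> eqp; rewrite /slice_value.
set A := [set N (space_of (f q)) | q in _].
(* The point [p] shows that the set of values is nonempty, so [xget] returns the potential at some
   point of the slice and not the default 0. *)
have [q qt <-] : A (xget 0 A) by apply: xgetPex; exists (N (space_of (f p))), p.
exact: eqp qt _.
Qed.

Lemma powR_three_halves (R : realType) (a : R) :
  0 < a -> a `^ (3 / 2) = a * Num.sqrt a.
Proof.
move=> a0; have -> : 3 / 2 = 1 + 2^-1 :> R by field.
rewrite powRD; last by rewrite (gt_eqF a0) implybT.
by rewrite powRr1 ?powR12_sqrt // ltW.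
Qed.

Unset Implicit Arguments.

Theorem proposition5p3 (R : realType) (n : nat)
    (M : chartedSpace R n) (g : M -> 'M[R]_n) (N : M -> R)
    (P : chartedSpace R n) (f : P -> line_times M)
    (eta : P -> 'rV[R]_(1 + n)) (nu : P -> 'rV[R]_n) :
  let G := static_metric g N in
  let tau := fun p : P => time_of (f p) in
  let u := slice_value N f in
  let du : R -> R := derive1 (u : R -> R^o) in
  let nuN := fun p : P => tderiv (N : M -> R^o) (space_of (f p)) (nu p) : R in
  let H := fun p : P => mean_curvature G f p (eta p) in
  let a := fun p : P =>
    1 - du (tau p) ^+ 2 / (u (tau p) ^+ 2 * nuN p ^+ 2) in
  let Z := fun p : P => ddt R n + (du (tau p) / nuN p) *: horizontal (nu p) in
  (3 <= n)%N ->
  static_spacetime g N ->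
  photon_surface g N f ->
  equipotential N f ->
  non_degenerate N f ->
  smooth_field_along f eta ->
  (forall p, unit_normal G f p (eta p)) ->
  (forall p, slice_unit_normal g f p (nu p)) ->
  (forall p, eta p = (Num.sqrt (a p))^-1 *:
     (horizontal (nu p) + (du (tau p) / (u (tau p) ^+ 2 * nuN p)) *: ddt R n)) ->
  [/\ forall p : P,
        u (tau p) * H p / n%:R * (a p `^ (3 / 2)) =
          a p * nuN p
          + (u (tau p))^-1
            * tangent_deriv f (fun q => du (tau q) / nuN q) p (Z p)
          - du (tau p) ^+ 2 / (u (tau p) ^+ 2 * nuN p),
      forall (t_ : nat -> R) (t0 : R),
        (forall i, slice_times f (t_ i) /\ t_ i <> t0) ->
        slice_times f t0 ->
        cluster (t_ @ \oo) t0 ->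
        (forall i, du (t_ i) = 0) ->
        forall p : P, slice f t0 p -> u t0 * H p = n%:R * nuN p
    & photon_sphere g N f ->
        forall p : P, N (space_of (f p)) * H p = n%:R * nuN p].
Proof.
move=> G tau u du nuN H a Z n3 st [mP emb tl umb] eqp nd seta etaN nuU etaE.
have dP := manifold_differentiable_atlas mP.
have [mM [gsym gpos _] _ N0] := st.
have dM := manifold_differentiable_atlas mM.
have dL := line_times_differentiable_atlas dM.
have [sf _ imm _] := emb.
pose h := fun q : P => du (tau q) / nuN q.
pose s := fun q : P => (Num.sqrt (a q))^-1.
have uN q : u (tau q) = N (space_of (f q)) by exact: slice_value_time_of.
(* With the convention that the inverse of 0 is 0, this identity also covers [nuN q = 0]. *)
have aE q : a q = 1 - h q ^+ 2 / N (space_of (f q)) ^+ 2.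
  by rewrite /a uN /h exprMn exprVn invfM mulrA mulrAC.
(* If [a q] were not positive, its square root and hence the inverse of that root would be 0, and
   [eta q] would be the zero vector, which is not a unit vector. *)
have a0 q : 0 < a q.
  rewrite -sqrtr_gt0 lt0r sqrtr_ge0 andbT; apply/eqP => sa0.
  have [] := etaN q; rewrite etaE sa0 invr0 scale0r /inner mul0mx mul0mx mxE.
  by move=> /esym/eqP; rewrite oner_eq0.
have s0 q : 0 < s q by rewrite invr_gt0 sqrtr_gt0.
have etaE' q : eta q = s q *:
    (horizontal (nu q) + (h q / N (space_of (f q)) ^+ 2) *: ddt R n).
  by rewrite etaE uN; congr (_ *: (_ + _ *: _)); rewrite /h invfM mulrA mulrAC.
have lE q : lsubmx (eta q) 0 0 = s q * (h q / N (space_of (f q)) ^+ 2).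
  rewrite etaE' linearZ linearD linearZ /= !row_mxKl add0r.
  by rewrite !mxE eqxx mulr1.
have rE q : rsubmx (eta q) = s q *: nu q.
  by rewrite etaE' linearZ linearD linearZ /= !row_mxKr scaler0 addr0.
have lZ q : lsubmx (Z q) 0 0 = 1.
  by rewrite linearD linearZ /= !row_mxKl scaler0 addr0 mxE eqxx.
have rZ q : rsubmx (Z q) = h q *: nu q.
  by rewrite linearD linearZ /= !row_mxKr add0r.
pose w q := xget 0 [set v : 'rV[R]_n | v *m tmap f q = Z q].
(* Z is orthogonal to [eta]: the time parts contribute [- s h] and the spatial parts [s h]. Hence Z
   is tangent to P and the [xget] defining [w] finds a true preimage. *)
have wZ q : w q *m tmap f q = Z q.
  suff ex : exists v : 'rV[R]_n, v *m tmap f q = Z q by exact: xgetPex ex.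
  have [nu1 _] := nuU q; have [eta1 orth] := etaN q.
  have Nq : N (space_of (f q)) != 0 by rewrite gt_eqF.
  apply: (@orthogonal_submx _ _ (G (f q)) _ (eta q)) => //.
  - by apply: static_metric_unitmx => //; apply: posdef_unitmx; exact: gpos.
  - apply/eqP => eta0; move: eta1; rewrite eta0 /inner mul0mx mul0mx mxE.
    by move=> /esym/eqP; rewrite oner_eq0.
  - rewrite /G /static_metric inner_block_diag lZ rZ lE rE innerZl innerZr nu1.
    by field.
have core q := static_sff st dP sf seta (fun q => proj2 (etaN q))
  (fun q => proj1 (nuU q)) s0 etaE' (wZ q).
(* The umbilic factor is compared with [static_sff] through the square of Z, which is
   [h^2 - N^2 = - N^2 a]. The last term is kept in terms of [h] until the end. *)
have formula q : u (tau q) * H q / n%:R * (a q `^ (3 / 2)) =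
    a q * nuN q + (u (tau q))^-1 * tangent_deriv f h q (Z q)
    - h q ^+ 2 * nuN q / u (tau q) ^+ 2.
  have [_ sffE] := core q; have [nu1 _] := nuU q.
  have [lambda sffl] := umb q _ (etaN q).
  have Iu := lorentzian_unitmx (tl q).
  rewrite /H (umbilic_mean_curvature Iu sffl) uN.
  have Nq : N (space_of (f q)) != 0 by rewrite gt_eqF.
  have n0 : n%:R != 0 :> R by rewrite pnatr_eq0 -lt0n (leq_trans _ n3).
  move: sffE; rewrite sffl /induced_metric inner_mulmx wZ.
  rewrite /static_metric inner_block_diag lZ rZ innerZl innerZr nu1.
  rewrite -/(tangent_deriv f h q (Z q)) -/(nuN q) powR_three_halves //.
  (* Writing [a] as [sa^2] and [h^2] as [(1 - sa^2) N^2] makes the identity rational in [sa]. *)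
  rewrite /s; set sa := Num.sqrt (a q).
  have sa0 : sa != 0 by rewrite gt_eqF // sqrtr_gt0.
  have sa2 : sa ^+ 2 = a q by rewrite sqr_sqrtr // ltW.
  have h2 : h q ^+ 2 = (1 - sa ^+ 2) * N (space_of (f q)) ^+ 2.
    by rewrite sa2 aE; field.
  move: (tangent_deriv _ _ _ _) (N _) Nq h2 => D Nq Nq0 h2 rel.
  have rel' : lambda * (sa ^+ 2 * Nq ^+ 2) =
      D / sa - 2 / sa * h q ^+ 2 * nuN q / Nq + Nq / sa * nuN q.
    apply: oppr_inj.
    transitivity (lambda * (- Nq ^+ 2 * 1 * 1 + h q * (h q * 1))).
      have -> : h q * (h q * 1) = (1 - sa ^+ 2) * Nq ^+ 2 by rewrite -h2; ring.
      by ring.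
    by rewrite rel; field; apply/andP.
  have -> : lambda = (D / sa - 2 / sa * h q ^+ 2 * nuN q / Nq + Nq / sa * nuN q)
      / (sa ^+ 2 * Nq ^+ 2) by rewrite -rel'; field; apply/andP.
  by rewrite -sa2 h2; field; apply/and3P.
have stationary q : h q = 0 -> tangent_deriv f h q (Z q) = 0 ->
    u (tau q) * H q = n%:R * nuN q.
  move=> h0 D0; have := formula q; rewrite D0 aE h0.
  rewrite expr0n /= !mul0r subr0 powR1 !mulr0 mul1r mulr1 addr0 subr0 => <-.
  by field; rewrite pnatr_eq0 -lt0n (leq_trans _ n3).
split.
- move=> p; rewrite formula; congr (_ - _).
  (* Where [nuN p = 0], both forms of the last term are 0 by the convention for the inverse of 0. *)
  rewrite /h; have [->|nu0] := eqVneq (nuN p) 0.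
    by rewrite !mulr0 mul0r invr0 mulr0.
  have Nq : u (tau p) != 0 by rewrite uN gt_eqF.
  by field; apply/andP.
- move=> t_ t0 tt _ clt dut p tp.
  have {}tp : tau p = t0 := tp; rewrite -[in u t0]tp.
  have [chP atP _] := dP; have [ap pp] := atP p; have [_ _ cPK _ _] := chP _ ap.
  set phi := chart_at p; set q0 := cmap phi p.
  pose F := cmap (chart_at (f p)) \o f \o cinv phi.
  pose i0 : 'I_(1 + n) := lshift n 0.
  have tauE : (fun y => tau (cinv phi y) : R^o) = fun y => F y 0 i0.
    by apply/funext => y; rewrite /F /= row_mxEl mxE eqxx mulr1n.
  have smF := near_chart_map_smooth p dP dL sf [::].
  (* The chart line through [p] with direction [w p] has velocity Z in spacetime, so time grows
     along it with derivative 1, the d/dt component of Z. *)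
  pose line (r : R) : 'rV[R]_n := r *: w p + q0.
  have line0 : cinv phi (line 0) = p by rewrite /line scale0r add0r cPK.
  have cline r : {for r, continuous line}.
    by apply: cvgD; [apply: cvgZr_tmp; exact: cvg_id|exact: cvg_cst].
  have hT : is_derive (0 : R) (1 : R)
      (fun r => tau (cinv phi (line r)) : R^o) 1.
    apply/(is_derive_lineP (fun y => tau (cinv phi y) : R^o)); rewrite tauE.
    have dF : differentiable F q0 := nbhs_singleton smF.
    have hF : is_derive q0 (w p) F (Z p).
      apply: (is_derive_eq (diff_is_derive (w p) dF)).
      by rewrite -(deriveE _ dF) (deriveEjacobian _ dF) -wZ.
    apply: (is_derive_eq (is_derive_mxE 0 i0 hF)).
    by rewrite -(lZ p) [RHS]mxE.
  (* [F] is differentiable not only at [q0] but near it, so time is continuous along the line near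
     0, as the intermediate value argument requires. *)
  have cT : \forall r \near (0 : R),
      {for r, continuous (fun r => tau (cinv phi (line r)) : R^o)}.
    have smF0 : nbhs (line 0) (fun y => differentiable F y).
      by rewrite /line scale0r add0r.
    apply: (@filterS _ (nbhs (0 : R)) _ [set r | differentiable F (line r)]);
      last exact: cline smF0.
    move=> r dF.
    have ct : {for line r, continuous (fun y => tau (cinv phi y) : R^o)}.
      rewrite tauE; apply: differentiable_continuous.
      exact: differentiable_mxE.
    exact: (@continuous_comp _ _ _ line (fun y => tau (cinv phi y) : R^o) r
      (@cline r) ct).
  have [dh _] := core p.
  have dH : derivable (fun r : R => h (cinv phi (line r)) : R^o) 0 1.
    exact: ((derivable1P _ _ _).1 dh).
  have [||i r|] := derive_eq0_of_accumulating_zeros hT cT dH (t_ := t_).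
  + by rewrite line0 tp.
  + by move=> i; rewrite line0 tp; have [] := tt i.
  + by move=> Tr; rewrite /h Tr dut mul0r.
  rewrite line0 => h0 D0; apply: (stationary _ h0).
  (* The derivative of [h] along the line is its derivative in the direction [w p], which is how
     [tangent_deriv] computes Z(h). *)
  have /is_derive_lineP[_ Dl] := derivableP dh.
  by rewrite -[LHS]Dl.
- move=> [_ [S [j [_ _ rf]]] Nc] p.
  rewrite -uN.
  (* The product shape of P puts the spatial point of [f p] into the slice of every time [t], so no
     value of [u] is the default one and all equal the constant potential. *)
  have uc : u = cst (N (space_of (f p))).
    apply/funext => t.
    have [q _ fq] : range f (t, space_of (f p)).
      rewrite rf; split=> //=.
      have : range f (f p) by exists p.
      by rewrite rf => -[].
    have <- : tau q = t by rewrite /tau /time_of fq.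
    by rewrite uN; exact: Nc.
  have du0 t : du t = 0 by rewrite /du uc derive1_cst.
  have h0 : h = cst 0 by apply/funext => q; rewrite /h du0 mul0r.
  have D0 : tangent_deriv f h p (Z p) = 0 by rewrite h0; exact: derive_cst.
  by apply: (stationary _ _ D0); rewrite h0.
Qed.
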